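(* Let $(X,T)$ be an inverse limit of minimal nilsystems and $d\in\mathbb{N}$. Then, for $x_0,x_1\in X$, the pair $(x_0,x_1)$ is an $\mathrm{IN}^{[d]}$-pair if and only if $(x_0,x_1)\in\mathbf{RP}^{[d]}(X)$.
   Context: $\mathbb{N}$ denotes the set of positive integers. A dynamical system $(X,T)$ is a compact metric space $X$ with metric $\rho$ together with a homeomorphism $T:X\to X$. It is minimal if every point has dense orbit $\{T^nx:n\in\mathbb{Z}\}$. A factor map is a continuous onto map intertwining the actions. Nilsystem: $X=G/\Gamma$ where $G$ is a nilpotent Lie group and $\Gamma$ a discrete cocompact subgroup, and $Tx=\tau x$ for some fixed $\tau\in G$. Inverse limit (sequential): given systems $(X_i,T_i)_{i\in\mathbb{N}}$ with $\mathrm{diam}(X_i)\leq1$ and factor maps $\phi_i:X_{i+1}\to X_i$, the inverse limit is $\{(x_i)_{i\in\mathbb{N}}\in\prod_i X_i:\phi_i(x_{i+1})=x_i,\ i\in\mathbb{N}\}$ with metric $\rho(x,y)=\sum_i 2^{-i}\rho_i(x_i,y_i)$ and the transformation induced by the $T_i$. For $\vec n\in\mathbb{Z}^d$ and $\epsilon\in\{0,1\}^d$ write $\vec n\cdot\epsilon=\sum_{i=1}^d n_i\epsilon(i)$. The regionally proximal relation of order $d$: $(x,y)\in\mathbf{RP}^{[d]}(X)$ if and only if for every $\delta>0$ there exist $x',y'\in X$ and $\vec n\in\mathbb{Z}^d$ such that $\rho(x,x')<\delta$, $\rho(y,y')<\delta$ and $\rho(T^{\vec n\cdot\epsilon}x',T^{\vec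 n\cdot\epsilon}y')<\delta$ for all $\epsilon\in\{0,1\}^d\setminus\{\vec 0\}$. For subsets $U_0,U_1\subset X$, a set $F\subset\mathbb{Z}$ is an independence set for $(U_0,U_1)$ if for every nonempty finite $J\subset F$ and every $s=(s(j):j\in J)\in\{0,1\}^J$ we have $\bigcap_{j\in J}T^{-j}U_{s(j)}\neq\emptyset$. A pair $(x_0,x_1)\in X\times X$ is an $\mathrm{IN}^{[d]}$-pair if for any $k\in\mathbb{N}$ and any neighborhoods $U_0,U_1$ of $x_0$ and $x_1$ respectively, there exist integers $p_j^{(i)}$, $1\leq i\leq k$, $1\leq j\leq d$, such that the $k(2^d-1)$ integers $p_1^{(i)}\epsilon(1)+\ldots+p_d^{(i)}\epsilon(d)$ ($1\leq i\leq k$, $\epsilon\in\{0,1\}^d\setminus\{\vec 0\}$) are nonzero and pairwise distinct and the set of all of them is an independence set for $(U_0,U_1)$. *)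

(* Defs.v *)
From HB Require Import structures.
From mathcomp Require Import all_boot all_order all_algebra.
From mathcomp Require Import all_classical all_reals all_analysis.
Set Implicit Arguments.
Unset Strict Implicit.
Unset Printing Implicit Defensive.

Import Order.TTheory GRing.Theory Num.Theory.
Import numFieldNormedType.Exports.

Local Open Scope classical_set_scope.
Local Open Scope ring_scope.

Record system (R : realType) := System {
  space :> metricType R;
  smap : space -> space;
  smap_inv : space -> space;
  smapK : cancel smap smap_inv;
  smap_invK : cancel smap_inv smap;
  smap_continuous : continuous smap;
  smap_inv_continuous : continuous smap_inv;
  space_compact : compact [set: space] }.

Definition iterz (R : realType) (X : system R) (n : int) : X -> X :=
  match n with
  | Posz m => iter m (@smap R X)
  | Negz m => iter m.+1 (@smap_inv R X)
  end.

Definition minimal (R : realType) (X : system R) : Prop :=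
  forall x : X, dense (range (fun n : int => iterz n x)).

Definition factor_map (R : realType) (X Y : system R) (f : X -> Y) : Prop :=
  [/\ continuous f, range f = [set: Y] & forall x, f (smap x) = smap (f x)].

Definition conjugate (X Y : topologicalType) (T : X -> X) (S : Y -> Y) : Prop :=
  exists (h : X -> Y) (g : Y -> X),
    [/\ cancel h g, cancel g h, continuous h, continuous g
      & forall x, h (T x) = S (h x)].

Record inverse_system (R : realType) := InverseSystem {
  level : nat -> system R;
  bond : forall i, level i.+1 -> level i;
  bond_factor : forall i, factor_map (@bond i);
  level_diam : forall i (x y : level i), mdist x y <= 1 }.

Record invlim (R : realType) (S : inverse_system R) := Thread {
  coord : forall i, level S i;
  coord_bond : forall i, bond (coord i.+1) = coord i }.

Section InverseLimit.
Variables (R : realType) (S : inverse_system R).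
Implicit Types x y z : invlim S.

Lemma invlim_ext x y : (forall i, coord x i = coord y i) -> x = y.
Proof.
case: x y => [x xP] [y yP] /= xy.
have e : x = y by apply: functional_extensionality_dep.
by subst y; congr Thread; apply: Prop_irrelevance.
Qed.

(* Indices start at 0, so the weight 2^-i of the level i >= 1 becomes
   2^-(i+1). *)
Definition invlim_dist x y : R :=
  limn (series (fun i => 2 ^- i.+1 * mdist (coord x i) (coord y i))).

Let term_ge0 x y i : 0 <= 2 ^- i.+1 * mdist (coord x i) (coord y i) :> R.
Proof. by rewrite mulr_ge0// ?invr_ge0 ?exprn_ge0// mdist_ge0. Qed.

Lemma invlim_dist_cvg x y :
  cvgn (series (fun i => 2 ^- i.+1 * mdist (coord x i) (coord y i) : R)).
Proof.
apply: (@series_le_cvg R _ (geometric 2^-1 2^-1)) => [i|i|i|].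
- exact: term_ge0.
- by rewrite /geometric /= mulr_ge0// ?exprn_ge0// invr_ge0.
- by rewrite /geometric /= -exprS exprVn ler_piMr ?level_diam//.
- apply: is_cvg_geometric_series.
  by rewrite ger0_norm ?invr_ge0// invf_lt1// ltr1n.
Qed.

Fact invlim_distxx x : invlim_dist x x = 0.
Proof.
rewrite /invlim_dist (_ : series _ = fun=> 0) ?lim_cst//.
apply/funext => n; rewrite /series /= big1// => i _.
by rewrite mdistxx mulr0.
Qed.

Fact invlim_dist_positivity x y : invlim_dist x y = 0 -> x = y.
Proof.
move=> xy0; apply: invlim_ext => i; apply: mdist_positivity.
apply/eqP; rewrite eq_le mdist_ge0 andbT.
have : series (fun i => 2 ^- i.+1 * mdist (coord x i) (coord y i)) i.+1
    <= invlim_dist x y :> R.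
  apply: nondecreasing_cvgn_le; last exact: invlim_dist_cvg.
  by apply: nondecreasing_series => n _ _; exact: term_ge0.
rewrite xy0 seriesSr => h.
have : 2 ^- i.+1 * mdist (coord x i) (coord y i) <= 0 :> R.
  by apply: le_trans h; rewrite lerDr /series /= sumr_ge0// => j _.
by rewrite pmulr_rle0// invr_gt0 exprn_gt0.
Qed.

Fact invlim_dist_sym x y : invlim_dist x y = invlim_dist y x.
Proof.
rewrite /invlim_dist; congr (limn (series _)); apply/funext => i.
by rewrite metric_sym.
Qed.

Fact invlim_dist_triangle y x z :
  invlim_dist x z <= invlim_dist x y + invlim_dist y z.
Proof.
rewrite /invlim_dist -limD; [|exact: invlim_dist_cvg..].
apply: ler_lim; first exact: invlim_dist_cvg.
  by apply: is_cvgD; exact: invlim_dist_cvg.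
near=> n; rewrite /series /= fctE -big_split /= ler_sum// => i _.
rewrite -mulrDr ler_wpM2l ?invr_ge0 ?exprn_ge0//.
exact: metric_triangle.
Unshelve. all: by end_near. Qed.

HB.instance Definition _ := gen_eqMixin (invlim S).
HB.instance Definition _ := gen_choiceMixin (invlim S).
HB.instance Definition _ := isMetric.Build R (invlim S)
  invlim_distxx invlim_dist_positivity invlim_dist_sym invlim_dist_triangle.

Fact invlim_map_subproof x i :
  bond (smap (coord x i.+1)) = smap (coord x i).
Proof. by have [_ _ ->] := bond_factor S i; rewrite coord_bond. Qed.

Definition invlim_map x : invlim S := Thread (invlim_map_subproof x).

End InverseLimit.

HB.mixin Record isTopGroup G of Group G & Topological G := {
  mulg_continuous : continuous (fun xy : G * G => (xy.1 * xy.2)%g);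
  invg_continuous : continuous (fun x : G => x^-1%g) }.

#[short(type="topGroupType")]
HB.structure Definition TopGroup :=
  { G of Group G & Topological G & isTopGroup G }.

(* C^k maps on an open subset U of a finite-dimensional space: f is C^(k+1)
   iff it is differentiable on U with all directional derivatives C^k. *)
Fixpoint Ck (R : realType) (V W : normedModType R) (U : set V) (k : nat)
    (f : V -> W) : Prop :=
  match k with
  | 0 => forall x, U x -> {for x, continuous f}
  | k'.+1 => (forall x, U x -> differentiable f x) /\
             (forall v, Ck U k' (fun x => 'D_v f x))
  end.

Definition smooth (R : realType) (V W : normedModType R) (U : set V)
    (f : V -> W) : Prop := forall k, Ck U k f.

Record chart (R : realType) (M : topologicalType) (n : nat) := Chart {
  cdom : set M;
  cmap : M -> 'rV[R]_n;
  cinv : 'rV[R]_n -> M;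
  cdom_open : open cdom;
  cim_open : open (cmap @` cdom);
  cmapK : forall x, cdom x -> cinv (cmap x) = x;
  cmap_continuous : {within cdom, continuous cmap};
  cinv_continuous : {within cmap @` cdom, continuous cinv} }.

Definition cim (R : realType) (M : topologicalType) (n : nat)
  (c : chart R M n) : set 'rV[R]_n := cmap c @` cdom c.

(* The atlas is not required to be maximal.  Manifolds are Hausdorff and second
   countable; the dimension may be 0 and the group may be disconnected. *)
Record lieGroup (R : realType) := LieGroup {
  lie_group :> topGroupType;
  lie_hausdorff : hausdorff_space lie_group;
  lie_second_countable : @second_countable lie_group;
  lie_dim : nat;
  lie_atlas : set (chart R lie_group lie_dim);
  lie_atlas_cover : \bigcup_(c in lie_atlas) cdom c = [set: lie_group];
  lie_atlas_compatible : forall a b, lie_atlas a -> lie_atlas b ->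
    smooth [set u | cim a u /\ cdom b (cinv a u)]
           (fun u => cmap b (cinv a u));
  lie_mul_smooth : forall a b c, lie_atlas a -> lie_atlas b -> lie_atlas c ->
    smooth [set uv : 'rV[R]_lie_dim * 'rV[R]_lie_dim |
              [/\ cim a uv.1, cim b uv.2
                & cdom c (cinv a uv.1 * cinv b uv.2)%g]]
           (fun uv => cmap c (cinv a uv.1 * cinv b uv.2)%g);
  lie_inv_smooth : forall a b, lie_atlas a -> lie_atlas b ->
    smooth [set u | cim a u /\ cdom b (cinv a u)^-1%g]
           (fun u => cmap b (cinv a u)^-1%g) }.

Record subgroup (G : groupType) := Subgroup {
  sg_set :> set G;
  sg1 : sg_set 1%g;
  sgM : forall x y, sg_set x -> sg_set y -> sg_set (x * y)%g;
  sgV : forall x, sg_set x -> sg_set x^-1%g }.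

Definition generated (G : groupType) (A : set G) : set G :=
  \bigcap_(H in [set H : subgroup G | A `<=` H]) H.

Fixpoint lower_central (G : groupType) (n : nat) : set G :=
  match n with
  | 0 => [set: G]
  | m.+1 => generated
      [set commg xy.1 xy.2 | xy in @lower_central G m `*` [set: G]]
  end.

Arguments lower_central G n : clear implicits.

Definition nilpotent_group (G : groupType) : Prop :=
  exists n, lower_central G n = [set 1%g].

Section CosetSpace.
Local Open Scope quotient_scope.
Variables (G : topGroupType) (Gamma : subgroup G).

Definition coset_rel : rel G := fun g h => `[< sg_set Gamma (g^-1 * h)%g >].

Fact coset_rel_equiv : equiv_class_of coset_rel.
Proof.
have sym g h : coset_rel g h -> coset_rel h g.
  move=> /asboolP gh; apply/asboolP.
  by rewrite -[(_ * _)%g]invgK invgM invgK; exact: sgV.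
split.
- by move=> g; apply/asboolP; rewrite mulVg; exact: sg1.
- by move=> g h; apply/idP/idP; exact: sym.
- move=> h g k /asboolP gh /asboolP hk; apply/asboolP.
  by have := sgM gh hk; rewrite mulgA mulgK.
Qed.

Canonical coset_equiv := EquivRelPack coset_rel_equiv.

(* G/Gamma, the space of the left cosets g Gamma *)
Definition coset_space := quotient_topology {eq_quot coset_equiv}.
HB.instance Definition _ := Topological.on coset_space.
HB.instance Definition _ := Quotient.on coset_space.

Definition coset_translate (tau : G) (x : coset_space) : coset_space :=
  \pi_coset_space (tau * repr x)%g.

Lemma coset_translateE (tau g : G) :
  coset_translate tau (\pi_coset_space g) = \pi_coset_space (tau * g)%g.
Proof.
apply/eqmodP; apply/asboolP; rewrite invgM -mulgA mulKg.
by apply/asboolP; rewrite -/(coset_rel _ _); apply/eqmodP; rewrite reprK.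
Qed.

End CosetSpace.

Definition discrete_subgroup (G : topGroupType) (Gamma : subgroup G) : Prop :=
  Gamma `<=` isolated Gamma.

Definition cocompact (G : topGroupType) (Gamma : subgroup G) : Prop :=
  compact [set: coset_space Gamma].

(* The metric of X is any one inducing the quotient topology of G/Gamma. *)
Definition nilsystem (R : realType) (X : system R) : Prop :=
  exists (G : lieGroup R) (Gamma : subgroup G) (tau : G),
    [/\ nilpotent_group G, discrete_subgroup Gamma, cocompact Gamma
      & conjugate (@smap R X) (@coset_translate G Gamma tau)].

(* Both here and in [nilsystem], equality of systems is taken up to
   topological conjugacy. *)
Definition invlim_of_minimal_nilsystems (R : realType) (X : system R) : Prop :=
  exists S : inverse_system R,
    (forall i, minimal (level S i) /\ nilsystem (level S i)) /\
    conjugate (@smap R X) (@invlim_map R S).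

Notation cube d := {ffun 'I_d -> bool}.
Definition cube0 (d : nat) : cube d := [ffun=> false].

Definition cdot (d : nat) (n : 'I_d -> int) (e : cube d) : int :=
  \sum_(i < d) n i *+ e i.

Definition RP (R : realType) (X : system R) (d : nat) : set (X * X) :=
  [set xy | forall delta : R, 0 < delta ->
    exists (x' y' : X) (n : 'I_d -> int),
      [/\ mdist xy.1 x' < delta, mdist xy.2 y' < delta
        & forall e : cube d, e != cube0 d ->
            mdist (iterz (cdot n e) x') (iterz (cdot n e) y') < delta]].

Arguments RP {R} X d _.

Definition independence_set (R : realType) (X : system R) (U0 U1 : set X)
    (F : set int) : Prop :=
  forall J : set int, J !=set0 -> finite_set J -> J `<=` F ->
  forall s : int -> bool,
    \bigcap_(j in J) (@iterz R X j @^-1` (if s j then U1 else U0)) !=set0.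

Definition IN_pair (R : realType) (X : system R) (d : nat) (x0 x1 : X) : Prop :=
  forall k : nat, (0 < k)%N -> forall U0 U1 : set X, nbhs x0 U0 -> nbhs x1 U1 ->
  exists p : 'I_k -> 'I_d -> int,
    [/\ forall i (e : cube d), e != cube0 d -> cdot (p i) e != 0,
        forall i i' (e e' : cube d), e != cube0 d -> e' != cube0 d ->
          cdot (p i) e = cdot (p i') e' -> i = i' /\ e = e'
      & independence_set U0 U1
          [set m | exists i (e : cube d), e != cube0 d /\ m = cdot (p i) e]].

(* Main.v *)
From HB Require Import structures.
Require Import Defs.
From mathcomp Require Import all_boot all_order all_algebra.
From mathcomp Require Import all_classical all_reals all_analysis.
From mathcomp Require Import zify lra.

(** The theorem holds for every minimal distal system, and an inverse limit of
minimal nilsystems is one.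

Distality.  If x = gH and y = glH are proximal in a compact quotient G/H then
1 is a limit of elements h l h' with h, h' in H ([coset_system_distal]).  When
l lies in the closure of G_n H, G_n being the lower central series, h l h'
lies in l times the closure of G_(n+1) H, so l lies in that smaller closure
([double_coset_closure]).  For G nilpotent this ends with l in the closure of
H, that is, x = y.  Distality and minimality then pass to inverse limits.

From independence to regional proximality, in any compact system
([IN_RP]).  Take k cubes p_i, with 2^k larger than the number of small
balls covering X, and for each f in {0,1}^k a point z_f which visits U_0 along
all these cubes, except that it visits U_1 at the top vertex of the cubes p_i
with f(i) = 1.  Two of these points z_f, z_g are close although f(i) <> g(i)
for some i, and the cube p_i read backwards from its top vertex is a witness for
the pair.

From regional proximality to independence ([RP_IN]).  Fix a set L of
exponents, functions from the vertices of the cube to the integers, closed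
under addition.  By the argument of Ellis, distality makes the pointwise
closure E of the maps (T^(lam i))_i, for lam in L, a group
([enveloping_inverse]); it acts on the closed set Q of the limits of cubes
(T^(lam i) z_a)_(i,a), where the points z_a vary freely.  A regionally proximal
pair (x, y) is a vertex of some cube of pairs in Q whose other vertices are
diagonal ([RP_corner_pair]).

Minimality writes that cube as u x with u in the enveloping group of two
copies of the cube; applying u to other points and dividing by one of its two
halves yields, for every tuple w with an entry equal to x, the cube in Q which is
constantly w except that the entry x becomes y at one vertex
([cubes_modify_corner]).  The same structure shows that the relation is open:
points near x have a partner near y ([corner_pair_neighborhood]).

Elements of Q are limits of cubes of points which only approximate their
base point.  By Baire's theorem this loses nothing for generic tuples z: the
cubes of Q having z as a vertex are exactly u z, with u in E
([exists_generic]).  So the previous modifications, one at each vertex and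
entry, can be composed by means of the group law: if every z_a has a partner
z'_a, any pattern of entries z_a and z'_a over the vertices is u z for some u in
E ([generic_pattern]).  Approximating u by an element of L gives points, as
close as desired to prescribed ones, which visit U_0 and U_1 along a cube in
any prescribed patterns.  One adds the cubes one at a time, the tuple being
indexed by all patterns ([independent_cubes]); that the sums be distinct
is obtained by restricting L to widely spaced exponents, which does not change the
group E ([enveloping_difference]). *)

Set Implicit Arguments.
Unset Strict Implicit.
Unset Printing Implicit Defensive.

Import Order.TTheory GRing.Theory Num.Theory.
Import numFieldNormedType.Exports.

Local Open Scope classical_set_scope.
Local Open Scope ring_scope.

(** * Topology of pointwise convergence, and Baire's theorem for compact spaces *)

Section Topology.

Lemma closure_image (S T : topologicalType) (f : S -> T) (A : set S)
    (B : set T) :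
  continuous f -> (forall x, A x -> B (f x)) ->
  forall x, closure A x -> closure B (f x).
Proof.
move=> fc AB x Ax V Vfx.
have [y [Ay Vy]] := Ax _ (fc x V Vfx).
by exists (f y); split => //; exact: AB.
Qed.

Lemma compact_image_closed (S T : topologicalType) (f : S -> T) (A : set S) :
  hausdorff_space T -> continuous f -> compact A -> closed (f @` A).
Proof.
move=> hT fc cA; apply: compact_closed => //; apply: continuous_compact => //.
exact: continuous_subspaceT.
Qed.

Variables (I : eqType) (T : topologicalType).

(** The sets U as in the conclusion form a filter, and it converges to f because
each of its coordinates does. *)
Lemma ptws_nbhsP (f : {ptws I -> T}) (U : set {ptws I -> T}) : nbhs f U ->
  exists (s : seq I) (V : I -> set T),
    (forall i, nbhs (f i) (V i)) /\
    (forall g, (forall i, i \in s -> V i (g i)) -> U g).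
Proof.
pose G : set_system {ptws I -> T} := [set U |
  exists (s : seq I) (V : I -> set T),
    (forall i, nbhs (f i) (V i)) /\
    (forall g, (forall i, i \in s -> V i (g i)) -> U g)].
suff : G --> f by apply.
have FG : Filter G.
  split.
  - by exists [::], (fun=> setT); split => // i; exact: filterT.
  - move=> P Q [s [V [Vf VP]]] [t [W [Wf WQ]]].
    exists (s ++ t), (fun i => V i `&` W i); split=> [i|g gVW].
      exact: filterI.
    split; [apply: VP|apply: WQ] => i si.
      by have [] := gVW i; rewrite ?mem_cat ?si.
    by have [] := gVW i; rewrite ?mem_cat ?si ?orbT.
  - move=> P Q PQ [s [V [Vf VP]]]; exists s, V; split => // g gV.
    exact/PQ/VP.
apply/cvg_sup => i U' [_ [[W oW <-] Wf WU]].
exists [:: i], (fun j => if j == i then W else setT); split.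
  by move=> j; case: eqVneq => [->|_]; [exact: open_nbhs_nbhs|exact: filterT].
by move=> g /(_ i); rewrite inE eqxx => /(_ isT) Wg; exact: WU.
Qed.

Lemma ptws_eval_continuous i : continuous (fun f : {ptws I -> T} => f i).
Proof. exact: (@proj_continuous I (fun=> T) i). Qed.

Lemma ptws_continuous (Y : topologicalType) (f : Y -> {ptws I -> T}) :
  (forall i, continuous (fun y => f y i)) -> continuous f.
Proof.
move=> fc y U /ptws_nbhsP[s [V [Vf VU]]].
apply: (@filterS _ _ _ [set y' | forall i, i \in s -> V i (f y' i)]).
  by move=> y' /VU.
elim: s {VU} => [|i s IHs]; first by apply: nearW.
have Vi : nbhs y [set y' | V i (f y' i)] by exact: fc.
apply: filterS2 Vi IHs => y' Vi IH j; rewrite inE => /predU1P[->//|]; exact: IH.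
Qed.

Lemma ptws_hausdorff : hausdorff_space T -> hausdorff_space {ptws I -> T}.
Proof. by move=> hT; apply: (@hausdorff_product I (fun=> T)) => i. Qed.

Lemma ptws_compact : compact [set: T] -> compact [set: {ptws I -> T}].
Proof.
move=> cT; rewrite (_ : setT = [set f : {ptws I -> T} | forall i, setT (f i)]).
  exact: (@tychonoff I (fun=> T) (fun=> setT)).
by apply/funext => f; apply/propext; split.
Qed.

Lemma ptws_nbhs_box (s : seq I) (f : {ptws I -> T}) (V : I -> set T) :
  (forall i, i \in s -> nbhs (f i) (V i)) ->
  nbhs f [set g : {ptws I -> T} | forall i, i \in s -> V i (g i)].
Proof.
elim: s => [_|i s IHs Vf].
  by apply: (@filterS _ _ _ setT) => [g _ i //|]; exact: filterT.
have Vi : nbhs f [set g : {ptws I -> T} | V i (g i)].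
  by apply: ptws_eval_continuous; apply: Vf; rewrite mem_head.
have {}IHs : nbhs f [set g : {ptws I -> T} | forall j, j \in s -> V j (g j)].
  by apply: IHs => j sj; apply: Vf; rewrite inE sj orbT.
apply: filterS2 Vi IHs => g Vi IH j; rewrite inE => /predU1P[->//|]; exact: IH.
Qed.

End Topology.

Lemma closure_box (I : eqType) (T : topologicalType) (A : set T)
    (f : {ptws I -> T}) : (forall i, closure A (f i)) ->
  closure [set g : {ptws I -> T} | forall i, A (g i)] f.
Proof.
move=> fA U /ptws_nbhsP[s [V [Vf VU]]].
have /choice[g gP] i : exists y, A y /\ V i y by exact: fA.
exists g; split; first by move=> i; have [] := gP i.
by apply: VU => i _; have [] := gP i.
Qed.

(** A chain of nonempty closed sets generates a proper filter; any cluster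
point of it belongs to all of them. *)
Lemma compact_chain (T : topologicalType) (A : set T) (F : set (set T)) :
  compact A -> F !=set0 -> total_on F subset ->
  (forall B, F B -> [/\ closed B, B !=set0 & B `<=` A]) ->
  exists p, forall B, F B -> B p.
Proof.
move=> cA [B0 FB0] tF FP.
have FF : ProperFilter (filter_from F id).
  apply: filter_from_proper; last by move=> B /FP[].
  apply: filter_from_filter; first by exists B0.
  move=> B C FB FC; have [BC|CB] := tF _ _ FB FC.
    by exists B => // x Bx; split => //; exact: BC.
  by exists C => // x Cx; split => //; exact: CB.
have [|p [_ pF]] := cA _ FF; first by exists B0 => //; have [] := FP _ FB0.
exists p => B FB; have [cB _ _] := FP _ FB; apply: cB => C pC.
by apply: pF => //; exists B.
Qed.

(** The analogue of Baire's theorem for complete spaces: shrink O to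
neighborhoods Q_0, Q_1, ... such that the closure of Q_(n+1) is inside Q_n and
avoids F_n; by compactness their intersection is nonempty. *)
Lemma baire_compact (T : topologicalType) (F : nat -> set T) (O : set T) :
  hausdorff_space T -> compact [set: T] -> open O -> O !=set0 ->
  (forall n, closed (F n)) -> (forall n, (F n)° = set0) ->
  exists2 x, O x & forall n, ~ F n x.
Proof.
move=> hT cT oO O0 cF iF.
pose good (P : set T) := open P /\ P !=set0.
have shrink (nP : nat * {P | good P}) : exists Q : {P | good P},
    forall x, closure (sval Q) x -> sval nP.2 x /\ ~ F nP.1 x.
  case: nP => n [P [oP [x Px]]] /=.
  have [y [Py nFy]] : exists y, P y /\ ~ F n y.
    apply: contrapT => H; suff : (F n)° x by rewrite iF.
    apply: (@filterS _ _ _ P); last exact: open_nbhs_nbhs.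
    by move=> y Py; apply: contrapT => nFy; apply: H; exists y.
  have [V yV VP] : exists2 V, nbhs y V & closure V `<=` P `&` ~` F n.
    apply: (compact_regular hT cT filterT); apply: open_nbhs_nbhs; split => //.
    by apply: openI => //; exact/closed_openC/cF.
  have gV : good V° by split; [exact: open_interior|exists y].
  exists (exist _ _ gV) => z /= zV; apply: VP.
  by apply: closureS zV; exact: interior_subset.
have [f fP] := choice shrink.
pose fix Q n : {P | good P} :=
  if n is m.+1 then f (m, Q m) else exist _ O (conj oO O0).
have QS n x : closure (sval (Q n.+1)) x -> sval (Q n) x /\ ~ F n x.
  by move=> /(fP (n, Q n)).
have Qle m n : (m <= n)%N -> closure (sval (Q n)) `<=` closure (sval (Q m)).
  move=> /subnK <-; elim: (n - m)%N => [//|k IHk] x.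
  by rewrite addSn => /QS[/subset_closure/IHk].
have [||_ [n _ <-]|p pQ] := @compact_chain T setT
    [set closure (sval (Q n)) | n in [set: nat]] cT.
- by exists (closure (sval (Q 0))); exists 0%N.
- move=> _ _ [m _ <-] [n _ <-].
  by have [/Qle|/ltnW/Qle] := leqP m n; [right|left].
- split=> //; first exact: closed_closure.
  have [_ [x xQ]] := svalP (Q n).
  by exists x; exact: subset_closure.
have {}pQ n : sval (Q n) p /\ ~ F n p by apply: QS; apply: pQ; exists n.+1.
by exists p => [|n]; [have [] := pQ 0%N|have [] := pQ n].
Qed.

Lemma compact_countable_base (R : realType) (T : pseudoMetricType R) :
  compact [set: T] -> exists b : nat -> set T,
    (forall n, open (b n)) /\
    forall x V, nbhs x V -> exists2 n, b n x & b n `<=` V.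
Proof.
move=> cT; have [[x0]|T0] := pselect (inhabited T); last first.
  exists (fun=> set0); split=> [n|x]; first exact: open0.
  by exfalso; apply: T0.
(* Pointing T gives access to the second countability of compact spaces. *)
pose P : pseudoPMetricType R := HB.pack T (isPointed.Build T x0).
have [B cB [Bo Bb]] := @compact_second_countable R P cT.
have /countable_injP[f fB] := cB.
pose b n : set T := [set x | exists U, [/\ B U, f U = n & U x]].
exists b; split.
  move=> n; rewrite openE => x [U [BU fU Ux]].
  apply: (@filterS _ _ _ U) => [y Uy|]; first by exists U.
  by apply: open_nbhs_nbhs; split => //; exact: Bo.
move=> x V /Bb[U [BU Ux] UV]; exists (f U); first by exists U.
move=> y [U' [BU' fU' Uy]]; apply: UV.
by rewrite -(fB U' U)// ?inE.
Qed.

(** * Enveloping semigroups of distal systems *)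

Section Dynamics.
Variables (R : realType) (X : system R).
Implicit Types x y z : X.

Lemma system_hausdorff : hausdorff_space X.
Proof. exact: metric_hausdorff. Qed.

Lemma system_closed1 x : closed [set x].
Proof.
by apply: accessible_closed_set1; apply: hausdorff_accessible;
  exact: system_hausdorff.
Qed.

Lemma iterz_succ (n : int) x : iterz (n + 1) x = smap (iterz n x).
Proof.
case: n => n; first by rewrite -PoszD addn1.
case: n => [|n].
  by rewrite (_ : Negz 0 + 1 = 0)//= smap_invK.
by rewrite (_ : Negz n.+1 + 1 = Negz n) ?NegzE; [rewrite /= smap_invK|lia].
Qed.

Lemma iterz_pred (n : int) x : iterz (n - 1) x = smap_inv (iterz n x).
Proof. by rewrite -[n in RHS](subrK 1) iterz_succ smapK. Qed.

Lemma iterzD (m n : int) x : iterz (m + n) x = iterz m (iterz n x).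
Proof.
elim: m => [|m IHm|m IHm].
- by rewrite add0r.
- by rewrite -addn1 PoszD addrAC !iterz_succ IHm.
- by rewrite -addn1 PoszD opprD addrAC !iterz_pred IHm.
Qed.

Lemma iterzK (n : int) x : iterz (- n) (iterz n x) = x.
Proof. by rewrite -iterzD addNr. Qed.

Lemma iterz_continuous (n : int) : continuous (@iterz R X n).
Proof.
elim: n => [|n IHn|n IHn] x.
- exact: cvg_id.
- rewrite (_ : iterz n.+1 = @smap R X \o iterz n) //.
  exact: continuous_comp (IHn x) (@smap_continuous R X _).
- rewrite (_ : iterz (- n.+1%:Z) = @smap_inv R X \o iterz (- n%:Z)); last first.
    apply: funext => y; rewrite [RHS]/= -iterz_pred; congr (iterz _ y); lia.
  exact: continuous_comp (IHn x) (@smap_inv_continuous R X _).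
Qed.

(** Stated without the metric: under a continuous equivariant map, the image of
a proximal pair is proximal. *)
Definition proximal x y : Prop :=
  exists a : X, forall V, nbhs a V ->
    exists n : int, V (iterz n x) /\ V (iterz n y).

Definition distal : Prop := forall x y, proximal x y -> x = y.

Section Enveloping.
Variable I : eqType.
Local Notation maps := {ptws I * X -> X}.
Implicit Types (u v w : maps) (L : set (I -> int)).

Definition power_map (lam : I -> int) : maps := fun ix => iterz (lam ix.1) ix.2.

Definition after u v : maps := fun ix => u (ix.1, v ix).

Definition idmap : maps := fun ix => ix.2.

(** For I a point and L all integers this is the enveloping semigroup of Ellis.
Its elements need not be continuous in the point of X, so that [after] is
continuous in its left argument only. *)
Definition enveloping L : set maps := closure [set power_map lam | lam in L].

Definition add_closed L : Prop :=
  forall lam mu, L lam -> L mu -> L (fun i => lam i + mu i).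

Lemma power_map_after lam mu :
  after (power_map lam) (power_map mu) = power_map (fun i => lam i + mu i).
Proof. by apply: funext => -[i x]; rewrite /after /power_map /= iterzD. Qed.

Lemma afterA u v w : after u (after v w) = after (after u v) w.
Proof. by []. Qed.

Lemma idmap_after u : after idmap u = u.
Proof. by []. Qed.

Lemma after_idmap u : after u idmap = u.
Proof. by apply: funext => -[]. Qed.

Lemma after_continuousl v : continuous (fun u => after u v).
Proof. by apply: ptws_continuous => ix; exact: ptws_eval_continuous. Qed.

Lemma after_power_continuous lam : continuous (after (power_map lam)).
Proof.
apply: ptws_continuous => ix u.
apply: (@continuous_comp _ _ _ (fun u : maps => u ix) (iterz (lam ix.1))).
  exact: ptws_eval_continuous.
exact: iterz_continuous.
Qed.

Lemma enveloping_closed L : closed (enveloping L).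
Proof. exact: closed_closure. Qed.

Lemma maps_hausdorff : hausdorff_space maps.
Proof. apply: ptws_hausdorff; exact: system_hausdorff. Qed.

Lemma closed_compact_maps (A : set maps) : closed A -> compact A.
Proof.
move=> cA; apply: (subclosed_compact cA _ (@subsetT _ A)).
by apply: ptws_compact; exact: space_compact.
Qed.

Lemma enveloping_power L lam : L lam -> enveloping L (power_map lam).
Proof. by move=> Llam; apply: subset_closure; exists lam. Qed.

Lemma enveloping_approx (J : eqType) L u (s : seq J) (k : J -> I * X)
    (V : J -> set X) :
  enveloping L u -> (forall j, j \in s -> nbhs (u (k j)) (V j)) ->
  exists2 lam, L lam &
    forall j, j \in s -> V j (iterz (lam (k j).1) (k j).2).
Proof.
move=> Lu uV; pose ev (w : maps) : {ptws J -> X} := fun j => w (k j).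
have evc : continuous ev.
  by apply: ptws_continuous => j; exact: ptws_eval_continuous.
have uW : nbhs u [set w | forall j, j \in s -> V j (ev w j)].
  have : nbhs (ev u) [set g | forall j, j \in s -> V j (g j)].
    exact: ptws_nbhs_box.
  exact: evc.
by have [_ [[lam Llam <-] lamV]] := Lu _ uW; exists lam.
Qed.

Lemma enveloping_sub (J : topologicalType) (f : maps -> J) (B : set J) L :
  continuous f -> closed B -> (forall lam, L lam -> B (f (power_map lam))) ->
  forall u, enveloping L u -> B (f u).
Proof.
move=> fc cB fB u Lu; rewrite (closure_id B).1 //.
by apply: closure_image fc _ _ Lu => _ [lam Llam <-]; exact: fB.
Qed.

(** Composition is not jointly continuous, but taking the two closures one after
the other is enough: the left factor is a limit of continuous maps. *)
Lemma enveloping_after L : add_closed L ->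
  forall u v, enveloping L u -> enveloping L v -> enveloping L (after u v).
Proof.
move=> LD u v Lu Lv.
apply: (enveloping_sub (@after_continuousl v) (@enveloping_closed L) _ Lu).
move=> lam Llam.
apply: (enveloping_sub (@after_power_continuous lam) (@enveloping_closed L) _ Lv).
move=> mu Lmu.
by rewrite power_map_after; apply: enveloping_power; exact: LD.
Qed.

(** The lemma of Ellis and Numakura.  By Zorn there is a minimal closed
subsemigroup A; for u in A, both A u and the set of v in A with v u = u are
closed subsemigroups, hence equal to A, and u u = u follows. *)
Lemma ellis_idempotent (S : set maps) :
  closed S -> S !=set0 -> (forall u v, S u -> S v -> S (after u v)) ->
  exists2 u, S u & after u u = u.
Proof.
move=> cS S0 SM.
pose good (A : set maps) := [/\ closed A, A !=set0, A `<=` S &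
  forall u v, A u -> A v -> A (after u v)].
(* The union of a chain of sets C corresponds to the intersection of the
   remaining semigroups S minus C, hence this detour by complements. *)
have [C [gC Cmax]] : exists C, good (S `\` C) /\
    forall B, C `<` B -> ~ good (S `\` B).
  apply: Zorn_bigcup => F Fgood totF.
  have [F0|F0] := pselect (F !=set0); last first.
    rewrite (_ : S `\` _ = S); first by split.
    apply/seteqP; split=> u; first by case.
    by move=> Su; split=> // -[B FB]; case: F0; exists B.
  have [||_ [B FB <-]|p pF] := @compact_chain maps S
      [set S `\` B | B in F] (closed_compact_maps cS).
  - by have [B FB] := F0; exists (S `\` B); exists B.
  - move=> _ _ [B FB <-] [C FC <-]; have [BC|CB] := totF _ _ FB FC.
      by right; exact: setDS.
    by left; exact: setDS.
  - by have [] := Fgood _ FB.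
  have SF u : (S `\` \bigcup_(B in F) B) u <-> forall B, F B -> (S `\` B) u.
    split=> [[Su Fu] B FB|uF]; first by split=> // Bu; apply: Fu; exists B.
    have [B FB] := F0; have [Su _] := uF _ FB.
    by split=> // -[C FC Cu]; have [] := uF _ FC.
  split.
  - rewrite (_ : _ `\` _ = \bigcap_(B in F) (S `\` B)).
      by apply: closed_bigI => B /Fgood[].
    by apply/seteqP; split=> u /SF.
  - by exists p; apply/SF => B FB; apply: pF; exists B.
  - by move=> u [].
  - move=> u v /SF uF /SF vF; apply/SF => B FB.
    by have [_ _ _] := Fgood _ FB; apply; [exact: uF|exact: vF].
have [cA [u Au] AS AM] := gC; clear gC.
have minA (B : set maps) : good B -> B `<=` S `\` C -> S `\` C `<=` B.
  move=> [cB B0 BS BM] BA v Av; apply: contrapT => nBv.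
  apply: (Cmax (C `|` (S `\` B))).
    split; first exact: subsetUl.
    by move=> /(_ v) Cv; have [Sv nCv] := Av; apply: nCv; apply: Cv; right.
  rewrite (_ : S `\` _ = B)//; apply/seteqP; split=> w.
    by move=> [Sw] /not_orP[_ nw]; apply: contrapT => nBw; apply: nw.
  by move=> Bw; have [Sw nCw] := BA _ Bw; split=> // -[|[]].
have Au_sub : S `\` C `<=` (fun v => after v u) @` (S `\` C).
  apply: minA; last by move=> _ [v Av <-]; exact: AM.
  split.
  - apply: compact_image_closed; first exact: maps_hausdorff.
      exact: after_continuousl.
    exact: closed_compact_maps.
  - by exists (after u u); exists u.
  - by move=> _ [v Av <-]; apply: AS; exact: AM.
  - move=> _ _ [v Av <-] [w Aw <-]; exists (after (after v u) w) => //.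
    by apply: (AM) => //; exact: AM.
have /(_ u Au)[_ uu] : S `\` C `<=` [set v | (S `\` C) v /\ after v u = u].
  apply: minA; last by move=> v [].
  split.
  - apply: closedI => //.
    rewrite (_ : (fun v => _) = (fun v => after v u) @^-1` [set u])//.
    apply: closed_comp; first by move=> ? _; exact: after_continuousl.
    by apply: accessible_closed_set1; apply: hausdorff_accessible;
      exact: maps_hausdorff.
  - by have [v Av vu] := Au_sub _ Au; exists v.
  - by move=> v [Av _]; exact: AS.
  - move=> v w [Av vu] [Aw wu]; split; first exact: AM.
    by rewrite -afterA wu.
by exists u => //; exact: AS.
Qed.

Section Distal.
Hypothesis dX : distal.

(** If u u = u, then u maps both x and u x to u x; as u is a limit of powers,
x and u x are proximal. *)
Lemma enveloping_idempotent L u : enveloping L u -> after u u = u -> u = idmap.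
Proof.
move=> Lu uu; apply: funext => -[i x] /=; apply/esym/dX.
exists (u (i, x)) => V uV.
have [|lam Llam lamV] := @enveloping_approx _ L u [:: (i, x); (i, u (i, x))]
    id (fun=> V) Lu.
  have uuix : u (i, u (i, x)) = u (i, x) by rewrite -[RHS](congr1 (@^~ (i, x)) uu).
  by move=> ix; rewrite !inE => /orP[]/eqP-> //; rewrite uuix.
exists (lam i); split; [apply: (lamV (i, x))|apply: (lamV (i, u (i, x)))];
  by rewrite !inE eqxx ?orbT.
Qed.

(** The compact semigroup E u contains an idempotent, which is the identity. *)
Lemma enveloping_left_inverse L : add_closed L ->
  forall u, enveloping L u -> exists2 v, enveloping L v & after v u = idmap.
Proof.
move=> LD u Lu.
have [||_ _ [v Lv <-] [w Lw <-]|_ [v Lv <-] vuvu] :=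
    @ellis_idempotent ((fun v => after v u) @` enveloping L).
- apply: compact_image_closed; first exact: maps_hausdorff.
    exact: after_continuousl.
  by apply: closed_compact_maps; exact: enveloping_closed.
- by exists (after u u); exists u.
- exists (after (after v u) w) => //.
  by do 2 apply: enveloping_after => //.
exists v => //; apply: (@enveloping_idempotent L) vuvu.
exact: (enveloping_after LD).
Qed.

Lemma enveloping_inverse L : add_closed L ->
  forall u, enveloping L u ->
  exists v, [/\ enveloping L v, after v u = idmap & after u v = idmap].
Proof.
move=> LD u Lu.
have [v Lv vu] := enveloping_left_inverse LD Lu.
have [w Lw wv] := enveloping_left_inverse LD Lv.
exists v; split=> //.
by rewrite -[u]idmap_after -wv -!afterA (afterA v u) vu idmap_after.
Qed.

(** The enveloping semigroup of L, being a group, contains the inverses of the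
powers in L, hence all quotients of such powers. *)
Lemma enveloping_difference L L' : add_closed L ->
  (forall mu, L' mu -> exists2 lam, L lam & L (fun i => mu i + lam i)) ->
  enveloping L' `<=` enveloping L.
Proof.
move=> LD L'L u L'u.
apply: (@enveloping_sub maps id (enveloping L) L' _ _ _ _ L'u).
- by move=> v; exact: cvg_id.
- exact: enveloping_closed.
move=> mu /L'L[lam Llam Lml] /=.
have [v [Lv _ lamv]] := enveloping_inverse LD (enveloping_power Llam).
have := enveloping_after LD (enveloping_power Lml) Lv.
by rewrite -power_map_after -afterA lamv after_idmap.
Qed.

End Distal.
End Enveloping.
End Dynamics.

(** * Dynamical cubes and generic tuples *)

Section Cubes.
Variables (R : realType) (X : system R).
Implicit Types x y : X.

Definition const_closed (I : Type) (L : set (I -> int)) : Prop :=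
  forall n, L (fun=> n).

Definition power_cube (I A : eqType) (lam : I -> int) (z : {ptws A -> X}) :
  {ptws I * A -> X} := fun ia => iterz (lam ia.1) (z ia.2).

(** The base points z are arbitrary and vary with lam: a limit of cubes need not
be the cube of any tuple of points, not even under the enveloping group. *)
Definition cubes (I A : eqType) (L : set (I -> int)) : set {ptws I * A -> X} :=
  closure [set c | exists2 lam, L lam & exists z, c = power_cube lam z].

Arguments cubes I A L : clear implicits.

Lemma power_cube_continuous (I A : eqType) (lam : I -> int) :
  continuous (@power_cube I A lam).
Proof.
apply: ptws_continuous => ia z.
apply: (@continuous_comp _ _ _ (fun z : {ptws A -> X} => z ia.2)
  (iterz (lam ia.1))).
  exact: ptws_eval_continuous.
exact: iterz_continuous.
Qed.

Lemma enveloping_diag (I : eqType) (L : set (I -> int))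
    (u : {ptws I * X -> X}) i0 : const_closed L ->
  enveloping L u -> enveloping L (fun ix => u (i0, ix.2)).
Proof.
move=> Lc.
apply: (@enveloping_sub _ _ _ {ptws I * X -> X}
  (fun u ix => u (i0, ix.2)) (enveloping L)).
- by apply: ptws_continuous => ix; exact: ptws_eval_continuous.
- exact: enveloping_closed.
by move=> lam Llam; apply: (enveloping_power (lam := fun=> lam i0)).
Qed.

Section Calculus.
Variables (I : eqType) (L : set (I -> int)).
Hypothesis LD : add_closed L.

Lemma cubes_act (A : eqType) (u : {ptws I * X -> X}) (c : {ptws I * A -> X}) :
  enveloping L u -> cubes I A L c -> cubes I A L (fun ia => u (ia.1, c ia)).
Proof.
move=> Lu Lc.
apply: (@enveloping_sub _ _ _ {ptws I * A -> X}
  (fun u ia => u (ia.1, c ia)) (cubes I A L)) Lu.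
- by apply: ptws_continuous => ia; exact: ptws_eval_continuous.
- exact: closed_closure.
move=> lam Llam.
apply: (@closure_image {ptws I * A -> X} {ptws I * A -> X}
  (fun c ia => power_map lam (ia.1, c ia))) Lc.
  apply: ptws_continuous => ia c'.
  apply: (@continuous_comp _ _ _ (fun c : {ptws I * A -> X} => c ia)
    (iterz (lam ia.1))).
    exact: ptws_eval_continuous.
  exact: iterz_continuous.
move=> _ [mu Lmu [z ->]]; exists (fun i => lam i + mu i); first exact: LD.
by exists z; apply: funext => -[i a]; rewrite /power_map /power_cube /= iterzD.
Qed.

Lemma cubes_sym (A : eqType) (s : I -> I) (c : {ptws I * A -> X}) :
  (forall lam, L lam -> L (lam \o s)) ->
  cubes I A L c -> cubes I A L (fun ia => c (s ia.1, ia.2)).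
Proof.
move=> Ls; apply: (@closure_image {ptws I * A -> X} {ptws I * A -> X}
  (fun c ia => c (s ia.1, ia.2))).
  by apply: ptws_continuous => ia; exact: ptws_eval_continuous.
move=> _ [mu Lmu [z ->]]; exists (mu \o s); first exact: Ls.
by exists z.
Qed.

Hypothesis Lc : const_closed L.

Lemma enveloping_id : enveloping L (@idmap _ X I).
Proof. exact: (enveloping_power (lam := fun=> 0)). Qed.

(** The exponents of independent translates, indexed by A, of cubes of the same
shape: with them one system X carries a cube for each index. *)
Definition spread (A : eqType) : set (A * I -> int) :=
  [set mu | exists2 lam, L lam & exists m : A -> int,
     mu = fun ai => lam ai.2 + m ai.1].

Arguments spread A : clear implicits.

Lemma spread_add_closed A : add_closed (spread A).
Proof.
move=> _ _ [lam Llam [m ->]] [lam' Llam' [m' ->]].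
exists (fun i => lam i + lam' i); first exact: LD.
by exists (fun a => m a + m' a); apply: funext => ai; rewrite addrACA.
Qed.

Lemma spread_const_closed A : const_closed (spread A).
Proof.
move=> n; exists (fun=> n) => //; exists (fun=> 0).
by apply: funext => ai; rewrite addr0.
Qed.

Lemma spread_slice (A : eqType) (u : {ptws (A * I) * X -> X}) a :
  enveloping (spread A) u -> enveloping L (fun ix => u ((a, ix.1), ix.2)).
Proof.
apply: (@enveloping_sub _ _ _ {ptws I * X -> X}
  (fun u ix => u ((a, ix.1), ix.2)) (enveloping L)).
- by apply: ptws_continuous => ix; exact: ptws_eval_continuous.
- exact: enveloping_closed.
move=> _ [lam Llam [m ->]].
by apply: (enveloping_power (lam := fun i => lam i + m a)); exact: LD.
Qed.

Lemma spread_cube (A B : eqType) (u : {ptws (A * I) * X -> X})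
    (k : B -> A) (w : B -> X) :
  enveloping (spread A) u ->
  cubes I B L (fun ib => u ((k ib.2, ib.1), w ib.2)).
Proof.
apply: (@enveloping_sub _ _ _ {ptws I * B -> X}
  (fun u ib => u ((k ib.2, ib.1), w ib.2)) (cubes I B L)).
- by apply: ptws_continuous => ix; exact: ptws_eval_continuous.
- exact: closed_closure.
move=> _ [lam Llam [m ->]]; apply: subset_closure; exists lam => //.
exists (fun b => iterz (m (k b)) (w b)); apply: funext => ib.
by rewrite /power_map /power_cube /= iterzD.
Qed.

Lemma closure_orbit x y :
  minimal X -> closure (range (fun n : int => iterz n x)) y.
Proof.
move=> mX V Vy.
have [||z [Vz xz]] := mX x V°; [by exists y|exact: open_interior|].
by exists z; split=> //; exact: interior_subset Vz.
Qed.

(** Each base point is a limit of points T^m x, so that cubes of arbitrary points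
are limits of cubes of x; the orbit of x under the enveloping group is
compact. *)
Lemma cubes_orbit (A : eqType) (c : {ptws I * A -> X}) x :
  minimal X -> cubes I A L c ->
  exists2 u : {ptws (A * I) * X -> X}, enveloping (spread A) u &
    forall i a, c (i, a) = u ((a, i), x).
Proof.
move=> mX.
pose f (u : {ptws (A * I) * X -> X}) : {ptws I * A -> X} :=
  fun ia => u ((ia.2, ia.1), x).
have cB : closed (f @` enveloping (spread A)).
  apply: compact_image_closed.
  - by apply: ptws_hausdorff; exact: system_hausdorff.
  - by apply: ptws_continuous => ix; exact: ptws_eval_continuous.
  - by apply: closed_compact_maps; exact: enveloping_closed.
suff SB : cubes I A L `<=` f @` enveloping (spread A).
  by move=> /SB[u uP <-]; exists u.
move=> c0 c0L; apply: (cB); move: c0 c0L; apply: closureS.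
move=> _ [lam Llam [z ->]]; apply: cB.
have zO : closure [set z' : {ptws A -> X} |
    forall a, range (fun n : int => iterz n x) (z' a)] z.
  by apply: closure_box => a; exact: closure_orbit.
apply: closure_image zO; first exact: power_cube_continuous.
move=> z' z'x; have /choice[m mP] a : exists n : int, iterz n x = z' a.
  by have [n _ <-] := z'x a; exists n.
exists (power_map (fun ai => lam ai.2 + m ai.1)).
  by apply: enveloping_power; exists lam => //; exists m.
by apply: funext => ia; rewrite /f /power_map /power_cube /= -mP iterzD.
Qed.

(** The regionally proximal relation in terms of limit cubes: the vertex i0
carries (x, y) and the other vertices carry diagonal pairs. *)
Definition corner_pair (i0 : I) x y : Prop :=
  exists2 c, cubes I bool L c &
    [/\ c (i0, false) = x, c (i0, true) = y &
        forall i, i != i0 -> c (i, false) = c (i, true)].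

Lemma corner_pair_act (u : {ptws I * X -> X}) i j x y : enveloping L u ->
  corner_pair i x y -> corner_pair i (u (j, x)) (u (j, y)).
Proof.
move=> Lu [c cL [<- <- cP]].
exists (fun ib => u (j, c ib)); last by split=> // k ki; rewrite cP.
have := cubes_act (enveloping_diag (i0 := j) Lc Lu) cL; exact.
Qed.

Hypothesis mX : minimal X.
Hypothesis dX : distal X.

(** Write the cube of pairs as (u_0 x, u_1 x), with (u_0, u_1) in the enveloping
group of two copies of I, and arrange that u_0 is the identity at the vertex i0.
The cube u_0 w, with u_1 x in place of u_0 x at the index a0, belongs to
[cubes]; so does its image under the inverse of u_0, which is the cube sought:
away from i0, u_1 x = u_0 x is brought back to x. *)
Lemma cubes_modify_corner i0 x y (A : eqType) (w : A -> X) a0 :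
  corner_pair i0 x y -> w a0 = x ->
  cubes I A L (fun ia => if (ia.1 == i0) && (ia.2 == a0) then y else w ia.2).
Proof.
move=> [c cL [cx cy cP]] wa0.
have SD := @spread_add_closed bool.
have [u0 Lu0 u0P] := cubes_orbit x mX cL.
have [v0 [Lv0 vu0 uv0]] := enveloping_inverse dX SD Lu0.
(* Precompose by the inverse of u0 at the vertex (false, i0); g fixes x. *)
pose g z := v0 ((false, i0), z).
have gx : g x = x.
  by rewrite -{1}cx u0P; exact: (congr1 (@^~ ((false, i0), x)) vu0).
pose u : {ptws (bool * I) * X -> X} := fun jx => u0 (jx.1, g jx.2).
have Lu : enveloping (spread bool) u.
  apply: (enveloping_after SD Lu0).
  exact: (enveloping_diag (@spread_const_closed bool) Lv0).
have uP i a : u ((a, i), x) = c (i, a) by rewrite /u /= gx u0P.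
have u_id z : u ((false, i0), z) = z.
  exact: (congr1 (@^~ ((false, i0), z)) uv0).
have Lv := spread_slice (a := false) Lu.
have [v' [Lv' v'v _]] := enveloping_inverse dX LD Lv.
have v'K i z : v' (i, u ((false, i), z)) = z.
  exact: (congr1 (@^~ (i, z)) v'v).
(* Apply u_1 to the entry a0 and u_0 to the others, then divide by u_0. *)
have := cubes_act Lv' (spread_cube (k := fun a => a == a0) (w := w) Lu).
congr (cubes _ _ _ _); apply: funext => -[i a] /=.
have [->|aa0] := eqVneq a a0; last by rewrite andbF v'K.
rewrite wa0 uP andbT; have [->|ii0] := eqVneq i i0.
  by rewrite cy -{1}[y]u_id v'K.
by rewrite -cP// -uP v'K.
Qed.

End Calculus.

Section Generic.
Variables (I A : finType) (L : set (I -> int)).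
Hypotheses (LD : add_closed L) (Lc : const_closed L).
Implicit Types z : {ptws A -> X}.

(** The limit cubes through a generic tuple are images of that tuple itself, not
merely limits of cubes of nearby tuples. *)
Definition generic z : Prop := forall (c : {ptws I * A -> X}) i,
  cubes I A L c -> (forall a, c (i, a) = z a) ->
  exists2 u, enveloping L u & forall j a, c (j, a) = u (j, z a).

(** For a basic open set B of cubes, the tuples having a cube in B form an open
set, whose boundary is nowhere dense; a tuple outside these countably many
boundaries is generic.  Indeed if B contains a limit cube through z, then z is a
limit of tuples with a cube in B, so it has a cube in B itself. *)
Lemma exists_generic (O : set {ptws A -> X}) : open O -> O !=set0 ->
  exists2 z, O z & generic z.
Proof.
move=> oO O0.
have [b [bo bP]] := compact_countable_base (@space_compact R X).
pose box (f : {ffun I * A -> nat}) : set {ptws I * A -> X} :=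
  [set c | forall ia, b (f ia) (c ia)].
have box_nbhs f c : box f c -> nbhs c (box f).
  move=> fc.
  have : nbhs c [set c' : {ptws I * A -> X} |
      forall ia, ia \in enum {: I * A} -> b (f ia) (c' ia)].
    by apply: (ptws_nbhs_box (V := fun ia => b (f ia))) => ia _;
      apply: open_nbhs_nbhs.
  by apply: filterS => c' c'P ia; apply: c'P; rewrite mem_enum.
pose hit f : set {ptws A -> X} :=
  [set z | exists2 lam, L lam & box f (power_cube lam z)].
have hit_open f : open (hit f).
  rewrite openE => z [lam Llam /box_nbhs zf].
  have zn : nbhs z [set z' | box f (power_cube lam z')].
    exact: power_cube_continuous zf.
  by apply: filterS zn => z' z'f; exists lam.
pose bd f := closure (hit f) `&` ~` hit f.
pose F n := if unpickle n is Some f then bd f else set0.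
have [||n|n|z Oz zF] := @baire_compact _ F O _ _ oO O0.
- by apply: ptws_hausdorff; exact: system_hausdorff.
- by apply: ptws_compact; exact: space_compact.
- rewrite /F; case: unpickle => [f|]; last exact: closed0.
  by apply: closedI; [exact: closed_closure|exact: open_closedC].
- rewrite /F; case: unpickle => [f|]; last exact: interior0.
  rewrite -subset0 => z zf.
  have [/(_ _ zf)[z' [hz' [_ nz']]] _] := interior_subset zf.
  exact: nz'.
exists z => // c i cL cz.
pose ev (u : {ptws I * X -> X}) : {ptws I * A -> X} :=
  fun ia => u (ia.1, z ia.2).
have cB : closed (ev @` enveloping L).
  apply: compact_image_closed.
  - by apply: ptws_hausdorff; exact: system_hausdorff.
  - by apply: ptws_continuous => ix; exact: ptws_eval_continuous.
  - by apply: closed_compact_maps; exact: enveloping_closed.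
suff [u Lu uc] : (ev @` enveloping L) c by exists u => // j a; rewrite -uc.
apply: cB => U /ptws_nbhsP[s [V [Vc VU]]].
have /choice[f fP] (ia : I * A) : exists n, b n (c ia) /\ b n `<=` V ia.
  by have [n bn nV] := bP _ _ (Vc ia); exists n.
pose ff := [ffun ia => f ia].
have boxU : box ff `<=` U.
  move=> c' c'f; apply: VU => ia _; have [_] := fP ia; apply.
  by have := c'f ia; rewrite ffunE.
have boxc : nbhs c (box ff).
  by apply: box_nbhs => ia; rewrite ffunE; have [] := fP ia.
have : hit ff z.
  apply: contrapT => nz; apply: (zF (pickle ff)); rewrite /F pickleK; split=> //.
  move=> W zW.
  have cW : nbhs c [set c' : {ptws I * A -> X} | W (fun a => c' (i, a))].
    pose slice (c' : {ptws I * A -> X}) : {ptws A -> X} := fun a => c' (i, a).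
    have sc : continuous slice.
      by apply: ptws_continuous => a; exact: ptws_eval_continuous.
    apply: sc; rewrite (_ : slice c = z)//; exact: funext.
  have [_ [[lam Llam [z0 ->]] [z0f z0W]]] := cL _ (filterI boxc cW).
  (* The vertex i becomes the base point: subtract lam i from all exponents. *)
  exists (fun a => iterz (lam i) (z0 a)); split=> //.
  exists (fun j => lam j + (fun=> - lam i) j); first exact: LD.
  move=> ja; have := z0f ja.
  by rewrite /power_cube -iterzD subrK.
move=> [lam Llam lamf]; exists (power_cube lam z); split; last exact: boxU.
by exists (power_map lam) => //; exact: enveloping_power.
Qed.

Hypotheses (mX : minimal X) (dX : distal X).

(** The pattern is filled in one entry at a time.  Suppose v z is the pattern s,
and let y = v_i0 z be its vertex i0.  The cube m constantly equal to y, except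
that its entry a0 is z' at the vertex i0, is a limit cube.  Brought
back by the inverse of v_i0 it has z as a vertex j <> i0, so it is u z.  Then
v u z is the next pattern: at i0 it is m, and elsewhere it is v z. *)
Lemma generic_pattern z (z' : A -> X) : generic z ->
  (forall i : I, exists j, j != i) ->
  (forall i a, corner_pair L i (z a) (z' a)) ->
  forall s : seq (I * A), exists2 u, enveloping L u &
    forall i a, u (i, z a) = if (i, a) \in s then z' a else z a.
Proof.
move=> gz I2 zz'; elim=> [|[i0 a0] s [v Lv vP]].
  by exists (@idmap _ X I) => //; exact: enveloping_id.
have [sia|nsia] := boolP ((i0, a0) \in s).
  exists v => // i a; rewrite vP inE; case: eqP => [->|//]; by rewrite sia.
have [j ji0] := I2 i0.
pose y a := v (i0, z a).
have ya0 : y a0 = z a0 by rewrite /y vP (negbTE nsia).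
have [vi [Lvi viv vvi]] := enveloping_inverse dX LD Lv.
have vK i x : vi (i, v (i, x)) = x by exact: (congr1 (@^~ (i, x)) viv).
have viK i x : v (i, vi (i, x)) = x by exact: (congr1 (@^~ (i, x)) vvi).
have mL := cubes_modify_corner LD Lc mX dX (zz' i0 a0) ya0.
have nL := cubes_act LD (enveloping_diag (i0 := i0) Lc Lvi) mL.
have [a|u Lu uP] := gz _ j nL; first by rewrite /= (negbTE ji0) /y vK.
exists (after v u); first exact: enveloping_after.
move=> i a; rewrite /after /= -uP /= inE xpair_eqE.
have [->|ii0] /= := eqVneq i i0; last by rewrite /y vK vP.
by rewrite viK; case: eqP => [->//|_]; rewrite /y vP.
Qed.

End Generic.
End Cubes.

(** * Openness of the corner relation *)

Section Neighborhood.
Variables (R : realType) (X : system R).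

Variables (I : eqType) (L : set (I -> int)).
Hypotheses (LD : add_closed L) (Lc : const_closed L).
Hypotheses (mX : minimal X) (dX : distal X).

(** The orbit closure of (x, y) projects onto X by minimality.  It is covered
by the translates, by powers of T, of its part near (x, y); by Baire's theorem
the projection of one of them, hence of that part itself, has interior. *)
Lemma corner_pair_neighborhood (i0 : I) (x y : X) (U V : set X) :
  (forall i, corner_pair L i x y) -> nbhs x U -> nbhs y V ->
  exists W, [/\ open W, W !=set0 & forall z, W z ->
    U z /\ exists2 z', V z' & forall i, corner_pair L i z z'].
Proof.
move=> xy xU yV.
have [U' xU' U'U] := uniform_regular xU.
have [V' yV' V'V] := uniform_regular yV.
pose ev (u : {ptws I * X -> X}) : X := u (i0, x).
pose good (n : int) := [set u : {ptws I * X -> X} | [/\ enveloping L u,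
  closure U' (iterz n (u (i0, x))) & closure V' (iterz n (u (i0, y)))]].
have good_closed n : closed (good n).
  have cl (A : set X) z : closed A ->
      closed [set u : {ptws I * X -> X} | A (iterz n (u (i0, z)))].
    move=> cA; pose f (u : {ptws I * X -> X}) := iterz n (u (i0, z)).
    rewrite (_ : [set u | _] = f @^-1` A)//.
    apply: closed_comp => // u _.
    apply: (@continuous_comp _ _ _ (fun u : {ptws I * X -> X} => u (i0, z))
      (iterz n)); [exact: ptws_eval_continuous|exact: iterz_continuous].
  rewrite (_ : good n = enveloping L
      `&` [set u | closure U' (iterz n (u (i0, x)))]
      `&` [set u | closure V' (iterz n (u (i0, y)))]).
    by apply: closedI; [apply: closedI; [exact: enveloping_closed|]|];
      apply: cl; exact: closed_closure.
  by apply/seteqP; split=> u; [move=> []|move=> [[]]].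
pose F k := if unpickle k is Some n then ev @` good n else set0.
have [n [q nq]] : exists n, (ev @` good n)° !=set0.
  apply: contrapT => nG.
  have [||||||p _ pF] := @baire_compact X F setT.
  - exact: system_hausdorff.
  - exact: space_compact.
  - exact: openT.
  - by exists x.
  - move=> k; rewrite /F; case: unpickle => [n|]; last exact: closed0.
    apply: compact_image_closed; first exact: system_hausdorff.
      exact: ptws_eval_continuous.
    exact: closed_compact_maps.
  - move=> k; rewrite /F; case: unpickle => [n|]; last exact: interior0.
    rewrite -subset0 => z zn; apply: nG.
    by exists n, z.
  have pO := closure_orbit (y := p) x mX.
  have [u Lu up] : exists2 u, enveloping L u & u (i0, x) = p.
    have cE : closed (ev @` enveloping L).
      apply: compact_image_closed; first exact: system_hausdorff.
        exact: ptws_eval_continuous.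
      by apply: closed_compact_maps; exact: enveloping_closed.
    suff [u Lu uP] : (ev @` enveloping L) p by exists u.
    apply: cE; apply: closureS pO => _ [n _ <-].
    exists (power_map (fun=> n)) => //; apply: enveloping_power; exact: Lc.
  have [v [Lv vu _]] := enveloping_inverse dX LD Lu.
  have vK z : v (i0, u (i0, z)) = z by exact: (congr1 (@^~ (i0, z)) vu).
  have [|lam Llam lamP] := @enveloping_approx _ X I _ L v
      [:: (p, U'); (u (i0, y), V')] (fun j => (i0, j.1)) (fun j => j.2) Lv.
    move=> j; rewrite !inE => /orP[]/eqP-> /=; last by rewrite vK.
    by rewrite -up vK.
  apply: (pF (pickle (lam i0))); rewrite /F pickleK.
  exists u => //; split=> //; apply: subset_closure.
    rewrite up; apply: (lamP (p, U')); by rewrite inE eqxx.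
  by apply: (lamP (u (i0, y), V')); rewrite !inE eqxx orbT.
exists (iterz (- n) @^-1` (ev @` good n)°); split.
- apply: open_comp; last exact: open_interior.
  by move=> z _; exact: iterz_continuous.
- by exists (iterz n q); rewrite /= iterzK.
move=> z /interior_subset[u [Lu zU' zV'] uz].
have zE : iterz n (u (i0, x)) = z.
  by rewrite -/(ev u) uz -{1}[n]opprK iterzK.
split; first by apply: U'U; rewrite -zE.
exists (iterz n (u (i0, y))); first exact: V'V.
move=> i; rewrite -zE.
apply: (@corner_pair_act _ _ _ _ LD Lc (power_map (fun=> n)) i i0).
  exact: enveloping_power.
exact: corner_pair_act.
Qed.

End Neighborhood.

(** * Exponents of the cube of dimension d *)

Section CubeExponents.
Variable d : nat.
Implicit Types (e : cube d) (p q : 'I_d -> int).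

Lemma cdot_cube0 p : cdot p (cube0 d) = 0.
Proof. by rewrite /cdot big1// => i _; rewrite ffunE. Qed.

Lemma cdotD p q e : cdot (fun i => p i + q i) e = cdot p e + cdot q e.
Proof. by rewrite /cdot -big_split; apply: eq_bigr => i _; rewrite mulrnDl. Qed.

Lemma cdotN p e : cdot (fun i => - p i) e = - cdot p e.
Proof. by rewrite /cdot -sumrN; apply: eq_bigr => i _; rewrite mulNrn. Qed.

(** The reflection of the cube exchanging the vertices 0 and e0. *)
Definition flip e0 e : cube d := [ffun i => e i (+) e0 i].

Lemma flipK e0 : involutive (flip e0).
Proof. by move=> e; apply/ffunP => i; rewrite !ffunE addbK. Qed.

Lemma cdot_flip p e0 e : cdot p (flip e0 e) =
  cdot p e0 + cdot (fun i => if e0 i then - p i else p i) e.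
Proof.
rewrite /cdot -big_split; apply: eq_bigr => i _; rewrite ffunE.
by case: (e i); case: (e0 i); rewrite /= ?mulr1n ?mulr0n ?addr0 ?add0r ?subrr.
Qed.

Definition cube_exponents : set (cube d -> int) :=
  [set lam | exists m p, lam = fun e => m + cdot p e].

Lemma cube_exponents_add : add_closed cube_exponents.
Proof.
move=> _ _ [m [p ->]] [n [q ->]]; exists (m + n), (fun i => p i + q i).
by apply: funext => e; rewrite cdotD addrACA.
Qed.

Lemma cube_exponents_const : const_closed cube_exponents.
Proof.
move=> n; exists n, (fun=> 0); apply: funext => e.
by rewrite /cdot big1 ?addr0// => i _; rewrite mul0rn.
Qed.

Lemma cube_exponents_flip e0 lam :
  cube_exponents lam -> cube_exponents (lam \o flip e0).
Proof.
move=> [m [p ->]]; exists (m + cdot p e0).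
exists (fun i => if e0 i then - p i else p i).
by apply: funext => e; rewrite /= cdot_flip addrA.
Qed.

(** Any injective additive function of the vertices would do; it serves to order
them. *)
Definition binary e : nat := (\sum_(i < d) 2 ^ i * e i)%N.

Lemma binary_cube0 : binary (cube0 d) = 0%N.
Proof. by rewrite /binary big1// => i _; rewrite ffunE muln0. Qed.

Lemma binary_inj : injective binary.
Proof.
suff H n (f g : nat -> bool) :
    (\sum_(i < n) 2 ^ i * f i = \sum_(i < n) 2 ^ i * g i)%N ->
    forall i, (i < n)%N -> f i = g i.
  move=> e e' ee'; apply/ffunP => i.
  pose ext (e : cube d) n := if insub n is Some j then e j else false.
  have extE (e1 : cube d) (j : 'I_d) : ext e1 j = e1 j by rewrite /ext valK.
  rewrite -!extE; apply: (H d) => //.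
  by rewrite -[LHS]/(\sum_(i < d) _)%N; under eq_bigr do rewrite extE;
    under [RHS]eq_bigr do rewrite extE.
elim: n f g => [//|n IHn] f g.
have step (h : nat -> bool) : (\sum_(i < n.+1) 2 ^ i * h i =
    h 0 + (\sum_(i < n) 2 ^ i * h i.+1).*2)%N.
  rewrite big_ord_recl expn0 mul1n -muln2 big_distrl /=; congr addn.
  by apply: eq_bigr => i _; rewrite /bump add1n expnS -mulnA mulnC.
rewrite !step => fg.
have fg0 : f 0%N = g 0%N.
  by have := congr1 odd fg; rewrite !oddD !odd_double !addbF !oddb.
have fgS : (\sum_(i < n) 2 ^ i * f i.+1 = \sum_(i < n) 2 ^ i * g i.+1)%N.
  by move: fg; rewrite fg0 => /addnI/double_inj.
by case=> [//|i]; rewrite ltnS => /(IHn (f \o succn) (g \o succn) fgS).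
Qed.

(** For K nonnegative this is a convex cone, unlike the mere distinctness of the
sums, so that the corresponding exponents form a semigroup. *)
Definition spaced (K : int) p : Prop := forall e e',
  (binary e < binary e')%N -> K < cdot p e' - cdot p e.

Lemma spaced_gt K p e : spaced K p -> e != cube0 d -> K < cdot p e.
Proof.
move=> Kp e0; rewrite -[X in _ < X]subr0 -(cdot_cube0 p); apply: Kp.
rewrite binary_cube0 lt0n; apply: contra_neq e0 => be.
by apply: binary_inj; rewrite binary_cube0.
Qed.

Lemma spaced_inj K p : 0 <= K -> spaced K p -> injective (cdot p).
Proof.
move=> K0 Kp e e' ee'; apply: binary_inj.
case: (ltngtP (binary e) (binary e')) => // /Kp; rewrite ee' subrr;
  by rewrite ltNge K0.
Qed.

Definition spaced_exponents (K : int) : set (cube d -> int) :=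
  [set lam | exists m, exists2 p, spaced K p & lam = fun e => m + cdot p e].

Lemma spaced_exponents_add K : 0 <= K -> add_closed (spaced_exponents K).
Proof.
move=> K0 _ _ [m [p Kp ->]] [n [q Kq ->]]; exists (m + n).
exists (fun i => p i + q i); last first.
  by apply: funext => e; rewrite cdotD addrACA.
move=> e e' ee'; have := Kp _ _ ee'; have := Kq _ _ ee'.
by rewrite !cdotD; lia.
Qed.

Lemma norm_cdot_le p e : `|cdot p e| <= \sum_(i < d) `|p i|.
Proof.
rewrite /cdot; apply: le_trans (ler_norm_sum _ _ _) _; apply: ler_sum => i _.
by case: (e i) => //=; rewrite mulr0n normr0.
Qed.

(** Adding a large multiple of the powers of 2 makes any exponents spaced. *)
Lemma spaced_exponents_difference K lam : 0 <= K -> cube_exponents lam ->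
  exists2 mu, spaced_exponents K mu &
    spaced_exponents K (fun e => lam e + mu e).
Proof.
move=> K0 [m [p ->]]; pose S := \sum_(i < d) `|p i|.
have S0 : 0 <= S by apply: sumr_ge0 => i _; exact: normr_ge0.
(* S bounds the sums of p, whose differences a spacing of K + 2 S absorbs. *)
pose M := K + 1 + S + S.
pose q (i : 'I_d) : int := M * (2 ^ i)%N%:Z.
have qE e : cdot q e = M * (binary e)%:Z.
  rewrite /cdot /binary -[X in _ = _ * X](natz) natr_sum mulr_sumr.
  by apply: eq_bigr => i _; rewrite natrM !natz /q; case: (e i) => /=;
    rewrite ?mulr1n ?mulr0n ?mulr1 ?mulr0.
have qM e e' : (binary e < binary e')%N -> M <= cdot q e' - cdot q e.
  move=> ee'; rewrite !qE -mulrBr; apply: ler_peMr; first by rewrite /M; lia.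
  by lia.
exists (cdot q).
  exists 0, q; last by apply: funext => e; rewrite add0r.
  by move=> e e' /qM; rewrite /M; lia.
exists m, (fun i => p i + q i); last by apply: funext => e; rewrite cdotD addrA.
move=> e e' /qM; rewrite !cdotD /M.
have := norm_cdot_le p e; have := norm_cdot_le p e'; rewrite -/S.
by lia.
Qed.

End CubeExponents.

(** * From regional proximality to independence *)

Section Main.
Variables (R : realType) (X : system R) (d : nat).

Lemma mdist_nbhs (x : X) (r : R) : 0 < r -> nbhs x [set y | mdist x y < r].
Proof. by move=> r0; rewrite -ballEmdist; exact: nbhsx_ballx. Qed.

Lemma mdist_small_eq (x y : X) :
  (forall r : R, 0 < r -> mdist x y < r + r + r) -> x = y.
Proof.
move=> xy; apply: mdist_positivity; apply/eqP.
rewrite eq_le mdist_ge0 andbT leNgt; apply/negP => xy0.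
by have := xy (mdist x y / 3); rewrite divr_gt0// => /(_ isT); lra.
Qed.

(** A cluster point of the witnesses of regional proximality, as the precision
goes to 0. *)
Lemma RP_corner_pair (x y : X) :
  RP X d (x, y) -> corner_pair (@cube_exponents d) (cube0 d) x y.
Proof.
move=> xyRP.
pose L := @cube_exponents d.
pose S (r : R) : set {ptws cube d * bool -> X} := [set c |
  [/\ cubes L c, mdist x (c (cube0 d, false)) < r,
      mdist y (c (cube0 d, true)) < r &
      forall e, e != cube0 d -> mdist (c (e, false)) (c (e, true)) < r]].
have S0 r : 0 < r -> S r !=set0.
  move=> /xyRP[x' [y' [n [xx' yy' nP]]]].
  exists (fun eb => iterz (cdot n eb.1) (if eb.2 then y' else x')).
  split=> //=; try by rewrite cdot_cube0.
  apply: subset_closure; exists (cdot n).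
    by exists 0, n; apply: funext => e; rewrite add0r.
  by exists (fun b => if b then y' else x').
have FF : ProperFilter (filter_from [set r : R | 0 < r] S).
  apply: filter_from_proper => //; apply: filter_from_filter.
    by exists 1; rewrite /= ltr01.
  move=> r s r0 s0; exists (Num.min r s); first by rewrite /= lt_min r0.
  by move=> c [cL]; rewrite !lt_min => /andP[cxr cxs] /andP[cyr cys] cP;
    split; split=> // e /cP; rewrite lt_min => /andP[].
have [|c [_ cF]] := @ptws_compact (cube d * bool)%type X (@space_compact R X) _ FF.
  exact: filterT.
have near_c (r : R) : 0 < r -> exists2 c', S r c' &
    forall eb, mdist (c eb) (c' eb) < r.
  move=> r0; have := @ptws_nbhs_box _ X (enum {: cube d * bool}) c
    (fun eb => [set z | mdist (c eb) z < r]).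
  move=> /(_ (fun eb _ => mdist_nbhs _ r0))/(cF (S r)).
  case; first by exists r.
  by move=> c' [c'S c'c]; exists c' => // eb; apply: c'c; rewrite mem_enum.
exists c.
  apply: closed_closure => U cU.
  have FL : filter_from [set r : R | 0 < r] S (cubes L).
    by exists 1; [rewrite /= ltr01|move=> c' []].
  exact: cF FL cU.
split.
- apply/esym/mdist_small_eq => r r0.
  have [c' [_ cx _ _] /(_ (cube0 d, false))] := near_c r r0.
  rewrite metric_sym => cc'.
  by have := metric_triangle x (c' (cube0 d, false)) (c (cube0 d, false)); lra.
- apply/esym/mdist_small_eq => r r0.
  have [c' [_ _ cy _] /(_ (cube0 d, true))] := near_c r r0.
  rewrite metric_sym => cc'.
  by have := metric_triangle y (c' (cube0 d, true)) (c (cube0 d, true)); lra.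
- move=> e e0; apply/mdist_small_eq => r r0.
  have [c' [_ _ _ /(_ e e0) ce] c'c] := near_c r r0.
  have := c'c (e, false); have := c'c (e, true).
  rewrite metric_sym => c1 c2.
  have := metric_triangle (c (e, false)) (c' (e, false)) (c (e, true)).
  have := metric_triangle (c' (e, false)) (c' (e, true)) (c (e, true)).
  lra.
Qed.

Lemma corner_pair_flip e0 (x y : X) :
  corner_pair (@cube_exponents d) (cube0 d) x y ->
  corner_pair (@cube_exponents d) e0 x y.
Proof.
move=> [c cL [cx cy cP]].
have r0 e : (flip e0 e == cube0 d) = (e == e0).
  apply/eqP/eqP => [re|->]; last by apply/ffunP => i; rewrite !ffunE addbb.
  apply: (can_inj (flipK e0)); rewrite re.
  by apply/ffunP => i; rewrite !ffunE addbb.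
exists (fun eb => c (flip e0 eb.1, eb.2)).
  by apply: cubes_sym cL => lam; exact: cube_exponents_flip.
have /eqP r00 : flip e0 e0 == cube0 d by rewrite r0.
by split; rewrite /= ?r00// => e ee0; rewrite cP// r0.
Qed.

Hypotheses (hd : (0 < d)%N) (mX : minimal X) (dX : distal X).

(** Choose a generic tuple z in the product of the sets W a.  The pattern which is
z at the vertex 0, and z or its partner as f prescribes at the others, is u z
with u in the enveloping group; approximate u by powers with spaced exponents
m + cdot p, and take T^m z as base points. *)
Lemma spaced_cube_visits (A : finType) (K : int) (U V W0 : set X)
    (W : A -> set X) (f : A -> cube d -> bool) :
  0 <= K -> open U -> open V ->
  (forall z, W0 z -> U z /\ exists2 z', V z' &
     forall e, corner_pair (@cube_exponents d) e z z') ->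
  (forall a, [/\ open (W a), W a !=set0 & W a `<=` W0]) ->
  exists2 p, spaced K p & exists z : A -> X, forall a, W a (z a) /\
    forall e, e != cube0 d ->
      (if f a e then V else U) (iterz (cdot p e) (z a)).
Proof.
move=> K0 oU oV W0P WP; pose L := @cube_exponents d.
pose O : set {ptws A -> X} := [set z | forall a, W a (z a)].
have oO : open O.
  rewrite openE => z zO.
  have : nbhs z [set g : {ptws A -> X} | forall a, a \in enum A -> W a (g a)].
    apply: ptws_nbhs_box => a _; have [oW _ _] := WP a.
    exact: open_nbhs_nbhs.
  by apply: filterS => g gP a; apply: gP; rewrite mem_enum.
have O0 : O !=set0.
  have /choice[z zP] a : exists x, W a x by have [_ [x]] := WP a; exists x.
  by exists z.
have [z zO gz] := exists_generic (@cube_exponents_add d)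
  (@cube_exponents_const d) oO O0.
have zW0 a : W0 (z a) by have [_ _] := WP a; apply; exact: zO.
have /choice[z' z'P] a : exists z', V z' /\ forall e, corner_pair L e (z a) z'.
  by have [_ [z' ? ?]] := W0P _ (zW0 a); exists z'.
have I2 (e : cube d) : exists e', e' != e.
  exists (flip [ffun=> true] e); apply/eqP => /ffunP/(_ (Ordinal hd)).
  by rewrite !ffunE addbT; case: (e _).
have [u Lu uP] := generic_pattern (@cube_exponents_add d)
  (@cube_exponents_const d) mX dX gz I2 (fun e a => (z'P a).2 e)
  [seq ea <- enum {: cube d * A} | (ea.1 != cube0 d) && f ea.2 ea.1].
have LuK := enveloping_difference dX (spaced_exponents_add K0)
  (fun lam => @spaced_exponents_difference d K lam K0) Lu.
pose N (ea : cube d * A) : set X :=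
  if ea.1 == cube0 d then W ea.2 else if f ea.2 ea.1 then V else U.
have [|lam [m [p Kp ->]] lamP] := @enveloping_approx _ X _ _ _ u
  (enum {: cube d * A}) (fun ea => (ea.1, z ea.2)) N LuK.
  move=> [e a] _; rewrite /N /= uP mem_filter mem_enum andbT /=.
  case: eqVneq => [_|_] /=.
    by have [oW _ _] := WP a; exact: open_nbhs_nbhs.
  case: (f a e); apply: open_nbhs_nbhs; split=> //; first by have [] := z'P a.
  by have [] := W0P _ (zW0 a).
exists p => //; exists (fun a => iterz m (z a)) => a; split.
  have := lamP (cube0 d, a); rewrite mem_enum => /(_ isT).
  by rewrite /N /= eqxx cdot_cube0 addr0.
move=> e e0; have := lamP (e, a); rewrite mem_enum => /(_ isT).
by rewrite /N /= (negbTE e0) addrC iterzD.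
Qed.

(** Induction on the number of cubes.  The set W a of the points following a
pattern a along the first k cubes is open, and one new cube is found for all
the patterns a simultaneously, and for all choices at its own vertices. *)
Lemma independent_cubes (U V W0 : set X) : open U -> open V ->
  open W0 -> W0 !=set0 ->
  (forall z, W0 z -> U z /\ exists2 z', V z' &
     forall e, corner_pair (@cube_exponents d) e z z') ->
  forall k, exists p : nat -> 'I_d -> int, [/\
    forall i e, (i < k)%N -> e != cube0 d -> 0 < cdot (p i) e,
    forall i j e e', (i < k)%N -> (j < k)%N ->
      e != cube0 d -> e' != cube0 d -> cdot (p i) e = cdot (p j) e' ->
      i = j /\ e = e' &
    forall f : nat -> cube d -> bool, exists2 z, W0 z &
      forall i e, (i < k)%N -> e != cube0 d ->
        (if f i e then V else U) (iterz (cdot (p i) e) z)].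
Proof.
move=> oU oV oW W0n W0P; elim=> [|k [p [p_gt0 p_inj pP]]].
  have [z Wz] := W0n.
  by exists (fun=> (fun=> 0)); split=> // f; exists z.
(* K bounds all the previous sums; the new sums exceed K. *)
pose K := \sum_(i < k) \sum_(j < d) `|p i j|.
have K0 : 0 <= K by do 2 apply: sumr_ge0 => ? _; exact: normr_ge0.
have pK i e : (i < k)%N -> cdot (p i) e <= K.
  move=> ik; apply: le_trans (ler_norm _) _; apply: le_trans (norm_cdot_le _ _) _.
  rewrite /K (bigD1 (Ordinal ik))//= lerDl.
  by do 2 apply: sumr_ge0 => ? _; exact: normr_ge0.
pose A : finType := ({ffun 'I_k * cube d -> bool} * {ffun cube d -> bool})%type.
pose W (a : A) : set X := W0 `&` [set z | forall ie, ie \in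
  enum {: 'I_k * cube d} -> ie.2 != cube0 d ->
  (if a.1 ie then V else U) (iterz (cdot (p ie.1) ie.2) z)].
have WP a : [/\ open (W a), W a !=set0 & W a `<=` W0].
  split; last by move=> z [].
    apply: openI => //; elim: (enum _) => [|ie s IHs].
      by rewrite (_ : [set _ | _] = setT); [exact: openT|exact/seteqP].
    rewrite (_ : [set _ | _] = [set z | ie.2 != cube0 d ->
        (if a.1 ie then V else U) (iterz (cdot (p ie.1) ie.2) z)] `&`
      [set z | forall je, je \in s -> je.2 != cube0 d ->
        (if a.1 je then V else U) (iterz (cdot (p je.1) je.2) z)]).
      apply: openI => //; case: eqVneq => _ /=.
        by rewrite (_ : [set _ | _] = setT); [exact: openT|exact/seteqP].
      rewrite (_ : [set _ | _] = iterz (cdot (p ie.1) ie.2) @^-1`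
          (if a.1 ie then V else U)).
        apply: open_comp; first by move=> z _; exact: iterz_continuous.
        by case: (a.1 ie).
      by apply/seteqP; split=> z; [apply|move=> ? _].
    apply/seteqP; split=> z /=.
      move=> zP; split; first by apply: zP; rewrite mem_head.
      by move=> je sj; apply: zP; rewrite inE sj orbT.
    by move=> [zi zs] je; rewrite inE => /predU1P[->//|]; exact: zs.
  pose f i e := if insub i is Some j then a.1 (j, e) else false.
  have [z Wz zP] := pP f; exists z; split=> // -[i e] _ /= e0.
  by have := zP i e (ltn_ord i) e0; rewrite /f valK.
have [q Kq [z zP]] := spaced_cube_visits (fun (a : A) e => a.2 e) K0 oU oV W0P WP.
have ltS i : (i < k.+1)%N = (i == k) || (i < k)%N by rewrite ltnS leq_eqVlt.
exists (fun i => if i == k then q else p i); split.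
- move=> i e; rewrite ltS; case: eqVneq => [_ _|_ /=].
    by move=> /(spaced_gt Kq); exact: le_lt_trans.
  exact: p_gt0.
- move=> i j e e'; rewrite !ltS.
  case: eqVneq => [->|_] /=; case: eqVneq => [->|_] /=.
  + by move=> _ _ _ _ /(spaced_inj K0 Kq).
  + move=> _ jk e0 _ eq; have := spaced_gt Kq e0.
    by rewrite eq ltNge pK.
  + move=> ik _ _ e0 eq; have := spaced_gt Kq e0.
    by rewrite -eq ltNge pK.
  + exact: p_inj.
- move=> f; pose a : A :=
    ([ffun ie : 'I_k * cube d => f ie.1 ie.2], [ffun e => f k e]).
  have [[Wz zp] zq] := zP a; exists (z a) => // i e.
  rewrite ltS; case: eqVneq => [-> _|_ /= ik] e0.
    by have := zq e e0; rewrite ffunE.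
  have := zp (Ordinal ik, e); rewrite mem_enum => /(_ isT e0).
  by rewrite ffunE.
Qed.

Lemma RP_IN (x y : X) : RP X d (x, y) -> IN_pair d x y.
Proof.
move=> xyRP k k0 U0 U1 xU0 yU1.
have xy e : corner_pair (@cube_exponents d) e x y.
  by apply: corner_pair_flip; exact: RP_corner_pair.
have [W0 [oW W0n W0P]] := corner_pair_neighborhood (@cube_exponents_add d)
  (@cube_exponents_const d) mX dX (cube0 d) xy (nbhs_interior xU0)
  (nbhs_interior yU1).
have [p [p_gt0 p_inj pP]] := independent_cubes (@open_interior _ _)
  (@open_interior _ _) oW W0n W0P k.
exists (fun i => p i); split.
- by move=> i e e0; rewrite gt_eqF// p_gt0.
- move=> i i' e e' e0 e'0 ee'.
  by have [/val_inj] := p_inj _ _ _ _ (ltn_ord i) (ltn_ord i') e0 e'0 ee'.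
move=> J _ _ JF s.
have [z _ zP] := pP (fun i e => s (cdot (p i) e)).
exists z => j /JF[i [e [e0 ->]]].
have := zP _ _ (ltn_ord i) e0.
by case: (s _) => /interior_subset.
Qed.

End Main.

(** * From independence to regional proximality *)

Section Pigeonhole.
Variables (R : realType) (X : system R) (d : nat).

(** Otherwise the complements of finite unions of balls generate a proper filter,
without cluster point. *)
Lemma compact_ball_cover (r : R) : 0 < r ->
  exists s : seq X, forall x : X, exists2 y, y \in s & mdist y x < r.
Proof.
move=> r0; apply: contrapT => /forallNP H.
pose far (s : seq X) : set X := [set x | forall y, y \in s -> ~ (mdist y x < r)].
have FF : ProperFilter (filter_from [set: seq X] far).
  apply: filter_from_proper.
    apply: filter_from_filter; first by exists [::].
    move=> s t _ _; exists (s ++ t) => // x xst.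
    by split=> y ys; apply: xst; rewrite mem_cat ys ?orbT.
  move=> s _; have /existsNP[x xs] := H s; exists x => y ys yx.
  by apply: xs; exists y.
have [|x [_ xF]] := @space_compact R X _ FF; first exact: filterT.
have [|y [yx xy]] := xF (far [:: x]) _ _ (mdist_nbhs x r0).
  by exists [:: x].
by apply: (yx x); rewrite ?mem_head.
Qed.

(** With x' = T^(p_i . 1) z_f, y' = T^(p_i . 1) z_g and exponents - p_i, the
vertex e of the cube is the vertex 1 - e of the cube p_i: for e = 1 the two
points are z_f and z_g, which are close; for the other e <> 0 both are close
to x. *)
Lemma IN_RP (x y : X) : (0 < d)%N -> IN_pair d x y -> RP X d (x, y).
Proof.
move=> hd xyIN r r0.
have r2 : 0 < r / 2 by rewrite divr_gt0.
have [s sP] := compact_ball_cover r2.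
(* 2 ^ k exceeds the number of balls. *)
pose k := (size s).+1.
have [p [p_neq0 p_inj pI]] := xyIN k isT _ _ (mdist_nbhs x r2) (mdist_nbhs y r0).
pose one : cube d := [ffun=> true].
have one0 : one != cube0 d.
  by apply/eqP => /ffunP/(_ (Ordinal hd)); rewrite !ffunE.
pose F := [set m | exists i (e : cube d), e != cube0 d /\ m = cdot (p i) e].
have finF : finite_set F.
  apply: (@sub_finite_set _ _ ((fun ie : 'I_k * cube d => cdot (p ie.1) ie.2) @`
    setT)); last exact/finite_image/finite_finset.
  by move=> _ [i [e [_ ->]]]; exists (i, e).
have F0 : F !=set0 by exists (cdot (p ord0) one), ord0, one.
pose col (f : {ffun 'I_k -> bool}) (m : int) :=
  [exists i, (m == cdot (p i) one) && f i].
have /choice[z zP] (f : {ffun 'I_k -> bool}) : exists z : X,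
    forall i e, e != cube0 d -> if (e == one) && f i
      then mdist y (iterz (cdot (p i) e) z) < r
      else mdist x (iterz (cdot (p i) e) z) < r / 2.
  have [z zF] := pI F F0 finF (@subset_refl _ F) (col f).
  exists z => i e e0.
  have := zF (cdot (p i) e); rewrite /preimage /= => /(_ _).
  have -> : col f (cdot (p i) e) = (e == one) && f i.
    apply/existsP/andP => [[j /andP[/eqP ij fj]]|[/eqP-> fi]]; last first.
      by exists i; rewrite eqxx.
    by have [-> ->] := p_inj _ _ _ _ e0 one0 ij; rewrite eqxx.
  move=> H; have {}H := H (ex_intro _ i (ex_intro _ e (conj e0 erefl))).
  by case: (_ && _) H.
have /choice[c cP] (f : {ffun 'I_k -> bool}) :
    exists j : 'I_k, mdist (nth x s j) (z f) < r / 2.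
  have [w ws wz] := sP (z f).
  have ik : (index w s < k)%N by rewrite ltnW// ltnS index_mem.
  by exists (Ordinal ik); rewrite /= nth_index.
have [f [g [cfg [i [fi gi]]]]] : exists f g, c f = c g /\
    exists i : 'I_k, f i = false /\ g i = true.
  have /injectivePn[f [g fg cfg]] : ~~ injectiveb c.
    apply/negP => /injectiveP/leq_card; rewrite card_ffun card_bool !card_ord.
    by rewrite leqNgt ltn_expl.
  have [i] : exists i, f i != g i.
    apply/existsP; apply: contraNT fg => /existsPn fg.
    by apply/eqP/ffunP => i; apply/eqP; rewrite -[_ == _]negbK fg.
  case fi: (f i); case gi: (g i) => // _.
    by exists g, f; split=> //; exists i.
  by exists f, g; split=> //; exists i.
exists (iterz (cdot (p i) one) (z f)), (iterz (cdot (p i) one) (z g)).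
exists (fun j => - p i j); split=> /=.
- have := zP f i one one0; rewrite eqxx fi /= => h; lra.
- by have := zP g i one one0; rewrite eqxx gi.
move=> e e0; rewrite -!iterzD cdotN.
have -> : - cdot (p i) e + cdot (p i) one = cdot (p i) (flip one e).
  apply/eqP; rewrite addrC subr_eq /cdot -big_split; apply/eqP.
  apply: eq_bigr => j _; rewrite !ffunE addbT.
  by case: (e j); rewrite /= ?mulr1n ?mulr0n ?add0r ?addr0.
have rone : flip one e != one.
  apply: contra_neq e0 => re; apply/ffunP => j.
  by move/ffunP/(_ j): re; rewrite !ffunE addbT; case: (e j).
have [->|re0] := eqVneq (flip one e) (cube0 d).
  rewrite cdot_cube0 /=; have := cP f; have := cP g; rewrite cfg.
  have := metric_triangle (z f) (nth x s (c g)) (z g).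
  by rewrite (metric_sym (z f) (nth x s (c g))); lra.
have := zP f i _ re0; have := zP g i _ re0; rewrite (negbTE rone) /=.
set a := iterz _ (z f); set b := iterz _ (z g).
by have := metric_triangle a x b; rewrite (metric_sym a x); lra.
Qed.

End Pigeonhole.

(** * Translations of compact quotients of nilpotent groups are distal *)

Section GroupClosures.
Local Open Scope group_scope.
Variable G : topGroupType.
Implicit Types x y g h l : G.

Lemma mulg_continuous_comp (Y : topologicalType) (f f' : Y -> G) :
  continuous f -> continuous f' -> continuous (fun t => f t * f' t).
Proof.
move=> fc f'c t.
apply: (@continuous_comp _ _ _ (fun t => (f t, f' t))
    (fun p : G * G => p.1 * p.2)).
  exact: cvg_pair (fc t) (f'c t).
exact: mulg_continuous.
Qed.

Lemma invg_continuous_comp (Y : topologicalType) (f : Y -> G) :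
  continuous f -> continuous (fun t => (f t)^-1).
Proof.
move=> fc t; apply: (@continuous_comp _ _ _ f (fun x : G => x^-1)); first exact: fc.
exact: invg_continuous.
Qed.

Lemma cst_continuousg (Y : topologicalType) (x : G) :
  continuous (fun _ : Y => x).
Proof. by move=> t; exact: cvg_cst. Qed.

Lemma id_continuousg : continuous (fun x : G => x).
Proof. by move=> x; exact: cvg_id. Qed.

Lemma conj_generated (A : set G) c : (forall x, A x -> A (x ^ c)) ->
  forall x, generated A x -> generated A (x ^ c).
Proof.
move=> Ac x xA H AH.
have H1 : sg_set H (1 ^ c) by rewrite conj1g; exact: sg1.
have HM y z : sg_set H (y ^ c) -> sg_set H (z ^ c) -> sg_set H ((y * z) ^ c).
  by rewrite conjMg; exact: sgM.
have HV y : sg_set H (y ^ c) -> sg_set H (y^-1 ^ c) by rewrite conjVg; exact: sgV.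
by apply: (xA (@Subgroup _ [set y | sg_set H (y ^ c)] H1 HM HV)) => y /Ac /AH.
Qed.

Lemma lower_central_conj n x c :
  lower_central G n x -> lower_central G n (x ^ c).
Proof.
elim: n x => [//|n IHn] x; apply: conj_generated => _ [[a b] [an _] <-].
exists (a ^ c, b ^ c); first by split=> //; exact: IHn.
by rewrite /= conjRg.
Qed.

Lemma lower_centralV n x : lower_central G n x -> lower_central G n x^-1.
Proof. by case: n => [//|n] xn H AH; apply: sgV; exact: xn. Qed.

Lemma lower_central_commg n x y :
  lower_central G n x -> lower_central G n.+1 [~ x, y].
Proof. by move=> xn H AH; apply: AH; exists (x, y). Qed.

Variable Gamma : subgroup G.

Definition central_closure n : set G :=
  closure [set g | exists x y,
    [/\ lower_central G n x, sg_set Gamma y & g = x * y]].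

Lemma central_closureM n g h : central_closure n g -> sg_set Gamma h ->
  central_closure n (g * h).
Proof.
move=> gn Gh; apply: (@closure_image _ _ (fun g => g * h)) gn.
  by apply: mulg_continuous_comp; [exact: id_continuousg|exact: cst_continuousg].
move=> _ [x [y [xn Gy ->]]]; exists x, (y * h); split=> //; first exact: sgM.
by rewrite mulgA.
Qed.

Lemma central_closureV n g : central_closure n g -> central_closure n g^-1.
Proof.
apply: (@closure_image _ _ (fun g => g^-1)).
  by apply: invg_continuous_comp; exact: id_continuousg.
move=> _ [x [y [xn Gy ->]]]; exists (x^-1 ^ y), y^-1; split.
- by apply: lower_central_conj; exact: lower_centralV.
- exact: sgV.
- by rewrite conjgE invgM !mulgA mulgK.
Qed.

(** On the dense part l = x y with x in the n-th term and y in Gamma,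
h^x = [x, h^-1] h, so that h^l = [x, h^-1]^y h^y. *)
Lemma central_closure_conj n h l : sg_set Gamma h -> central_closure n l ->
  central_closure n.+1 (h ^ l).
Proof.
move=> Gh; apply: (@closure_image _ _ (fun l => h ^ l)).
  apply: mulg_continuous_comp.
    by apply: invg_continuous_comp; exact: id_continuousg.
  by apply: mulg_continuous_comp; [exact: cst_continuousg|exact: id_continuousg].
move=> _ [x [y [xn Gy ->]]]; exists ([~ x, h^-1] ^ y), (h ^ y); split.
- by apply: lower_central_conj; exact: lower_central_commg.
- by apply: sgM; [exact: sgV|exact: sgM].
- by rewrite -conjMg conjgM; congr conjg; rewrite commgEr invgK mulgVK.
Qed.

(** Since h l h' = l h^l h', the limit 1 lies in l times the next
[central_closure] as soon as l lies in the previous one. *)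
Lemma double_coset_closure l : nilpotent_group G ->
  closure [set g | exists h h',
    [/\ sg_set Gamma h, sg_set Gamma h' & g = h * l * h']] 1 ->
  closure Gamma l.
Proof.
move=> [n Gn] ll.
have {ll} ln m : central_closure m l.
  elim: m => [|m IHm].
    by apply: subset_closure; exists l, 1; rewrite mulg1; split=> //; exact: sg1.
  suff : central_closure m.+1 (l^-1 * 1).
    by rewrite mulg1 => /central_closureV; rewrite invgK.
  apply: closed_closure.
  apply: (@closure_image _ _ (fun g => l^-1 * g)) ll.
    by apply: mulg_continuous_comp; [exact: cst_continuousg|exact: id_continuousg].
  move=> _ [h [h' [Gh Gh' ->]]].
  rewrite (_ : _ * _ = h ^ l * h'); last by rewrite conjgE !mulgA.
  by apply: central_closureM => //; exact: central_closure_conj.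
apply: closureS (ln n) => _ [x [y [+ Gy ->]]].
by rewrite Gn => ->; rewrite mul1g.
Qed.

End GroupClosures.

Section CosetSystem.
Local Open Scope quotient_scope.
Local Open Scope group_scope.
Variables (G : topGroupType) (Gamma : subgroup G).
Implicit Types g h k : G.
Local Notation Y := (coset_space Gamma).

Lemma coset_eq g h : (\pi_Y g = \pi_Y h) <-> sg_set Gamma (g^-1 * h).
Proof.
split=> [/eqmodP/asboolP//|gh]; by apply/eqmodP/asboolP.
Qed.

(** The quotient map is open: the preimage of the image of an open set is a union
of its right translates by elements of Gamma. *)
Lemma pi_nbhs g (V : set G) : nbhs 1 V ->
  nbhs (\pi_Y g) [set y | exists2 v, V v & y = \pi_Y (v * g)].
Proof.
move=> V1; apply: (@filterS _ _ _ [set y | exists2 v, V° v & y = \pi_Y (v * g)]).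
  by move=> y [v /interior_subset Vv ->]; exists v.
apply: open_nbhs_nbhs; split; last by exists 1; rewrite ?mul1g.
rewrite /open/= /quotient_open openE => k [v Vv /coset_eq kv].
pose f k' := k' * (k^-1 * v).
have fc : continuous f.
  by apply: mulg_continuous_comp; [exact: id_continuousg|exact: cst_continuousg].
have fk : nbhs k (f @^-1` V°).
  by apply: fc; rewrite /f mulVKg; apply: open_nbhs_nbhs;
    split => //; exact: open_interior.
apply: filterS fk => k' Vk'; exists (f k') => //; apply/coset_eq.
by rewrite /f -!mulgA mulKg.
Qed.

Variables (R : realType) (X : system R) (tau : G) (phi : X -> Y) (psi : Y -> X).
Hypothesis phiK : cancel phi psi.
Hypotheses (phi_cont : continuous phi) (psi_cont : continuous psi).
Hypothesis phiT : forall x, phi (smap x) = coset_translate tau (phi x).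

Lemma pi_surj y : exists g, y = \pi_Y g.
Proof. by exists (repr y); rewrite reprK. Qed.

(** The element k is tau^n. *)
Lemma iterz_translate (n : int) : exists k, forall x g,
  phi x = \pi_Y g -> phi (iterz n x) = \pi_Y (k * g).
Proof.
elim: n => [|n [k kP]|n [k kP]].
- by exists 1 => x g; rewrite mul1g.
- exists (tau * k) => x g /kP xg.
  by rewrite -addn1 PoszD iterz_succ phiT xg coset_translateE mulgA.
- exists (tau^-1 * k) => x g /kP.
  rewrite (_ : (- n.+1%:Z)%R = (- n%:Z - 1)%R); last by lia.
  rewrite iterz_pred; move: (iterz _ x) => z zk.
  have [g' zg'] := pi_surj (phi (smap_inv z)).
  rewrite zg'; apply/coset_eq.
  have := phiT (smap_inv z); rewrite smap_invK zg' zk coset_translateE.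
  by move=> /esym/coset_eq; rewrite invgM !mulgA.
Qed.

(** If T^n x = v bH and T^n y = w bH with v, w close to 1, where x = gH and
y = glH, then h l h' = b^-1 v^-1 w b is close to 1 for some h, h' in H. *)
Lemma coset_system_distal : nilpotent_group G -> distal X.
Proof.
move=> Gnil x y [a xya].
have [g xg] := pi_surj (phi x); have [g' yg] := pi_surj (phi y).
have [b ab] := pi_surj (phi a).
pose l := g^-1 * g'.
suff lG : closure Gamma l.
  pose f k := psi (\pi_Y (g * k)).
  have fc : continuous f.
    move=> k; apply: (@continuous_comp _ _ _ (fun k => \pi_Y (g * k)) psi);
      last exact: psi_cont.
    apply: (@continuous_comp _ _ _ (fun k => g * k) \pi_Y).
      by apply: mulg_continuous_comp; [exact: cst_continuousg|exact: id_continuousg].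
    exact: pi_continuous.
  have : closed [set x] by exact: system_closed1.
  have : closure [set x] (f l).
    apply: closure_image fc _ _ lG => k Gk; rewrite /f -[x]phiK xg.
    by congr psi; apply/coset_eq; rewrite invgM -mulgA mulVg mulg1; exact: sgV.
  by move=> xfl cx; rewrite -[LHS](cx _ xfl) /f /l mulVKg -yg phiK.
apply: double_coset_closure => // W W1.
pose f (v : G * G) := b^-1 * (v.1^-1 * (v.2 * b)).
have fc : continuous f.
  have c1 : continuous (fun v : G * G => v.1) by move=> v; exact: cvg_fst.
  have c2 : continuous (fun v : G * G => v.2) by move=> v; exact: cvg_snd.
  apply: mulg_continuous_comp; first exact: cst_continuousg.
  apply: mulg_continuous_comp; first exact: invg_continuous_comp.
  by apply: mulg_continuous_comp => //; exact: cst_continuousg.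
have : nbhs (1, 1) (f @^-1` W).
  by apply: fc; rewrite /f /= invg1 !mul1g mulVg.
move=> [[V1 V2] [/= V11 V21] VW].
have V1' : nbhs 1 (V1 `&` V2) by exact: filterI.
have := pi_nbhs b V1'; rewrite -ab => /phi_cont/xya[n [] /=].
have [k kP] := iterz_translate n.
rewrite (kP _ _ xg) (kP _ _ yg) => -[v [Vv _] /coset_eq vg]
  [w [_ Vw] /coset_eq wg].
exists (f (v, w)); split; last exact: VW.
exists ((v * b)^-1 * (k * g)), (((w * b)^-1 * (k * g'))^-1); split.
- by have := sgV vg; rewrite invgM invgK.
- by rewrite invgM invgK.
- by rewrite /f /l /= !invgM !invgK !mulgA !(mulgK, mulgVK).
Qed.

End CosetSystem.

(** * Inverse limits *)

Section InverseLimits.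
Variables (R : realType) (S : inverse_system R).

(** The distance of two threads is at least each term of the series defining
it. *)
Lemma coord_continuous i : continuous (fun t : invlim S => Defs.coord t i).
Proof.
move=> t U /nbhs_ballP[r /= r0 rU].
have w0 : 0 < 2 ^- i.+1 :> R by rewrite invr_gt0 exprn_gt0.
apply/nbhs_ballP; exists (2 ^- i.+1 * r); first by rewrite /= mulr_gt0.
move=> t'; rewrite ballEmdist /= => tt'; apply: rU; rewrite ballEmdist /=.
rewrite -(ltr_pM2l w0); apply: le_lt_trans tt'.
have term_ge0 j : 0 <= 2 ^- j.+1 * mdist (Defs.coord t j) (Defs.coord t' j) :> R.
  by rewrite mulr_ge0 ?mdist_ge0// invr_ge0 exprn_ge0.
apply: (@le_trans _ _
    (series (fun j => 2 ^- j.+1 * mdist (Defs.coord t j) (Defs.coord t' j)) i.+1)).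
  by rewrite seriesSr lerDr /series /= sumr_ge0.
apply: nondecreasing_cvgn_le; last exact: invlim_dist_cvg.
by apply: nondecreasing_series => j _ _; exact: term_ge0.
Qed.

Variables (X : system R) (phi : X -> invlim S) (psi : invlim S -> X).
Hypotheses (phiK : cancel phi psi) (phi_cont : continuous phi).
Hypothesis phiT : forall x, phi (smap x) = invlim_map (phi x).

Let proj i (x : X) := Defs.coord (phi x) i.

Lemma proj_iterz i n x : proj i (iterz n x) = iterz n (proj i x).
Proof.
have projT y : proj i (smap y) = smap (proj i y) by rewrite /proj phiT.
elim: n => [//|n IHn|n IHn].
  by rewrite -addn1 PoszD !iterz_succ projT IHn.
rewrite (_ : - n.+1%:Z = - n%:Z - 1); last by lia.
rewrite !iterz_pred -IHn; move: (iterz _ x) => y.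
by rewrite -[in RHS](smap_invK y) projT smapK.
Qed.

Lemma proj_cont i : continuous (proj i).
Proof.
move=> x; apply: (@continuous_comp _ _ _ phi (fun t => Defs.coord t i)).
  exact: phi_cont.
exact: coord_continuous.
Qed.

Lemma proj_separate x y : (forall i, proj i x = proj i y) -> x = y.
Proof. by move=> xy; apply: (can_inj phiK); exact: invlim_ext. Qed.

Lemma invlim_distal : (forall i, distal (level S i)) -> distal X.
Proof.
move=> dS x y [a xya]; apply: proj_separate => i; apply: dS.
exists (proj i a) => V /proj_cont/xya[n [xV yV]].
by exists n; rewrite -!proj_iterz.
Qed.

(** The closure C of an orbit maps onto every level, so that for each i it
contains a point agreeing with y at the level i, hence at all levels below.  By
compactness some point of C agrees with y at all levels. *)
Lemma invlim_minimal : (forall i, minimal (level S i)) -> minimal X.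
Proof.
move=> mS x O [y Oy] oO; pose C := closure (range (fun n : int => iterz n x)).
have cC : compact C.
  by apply: (subclosed_compact (@closed_closure _ _) (@space_compact R X)).
pose B i := C `&` [set c | proj i c = proj i y].
have B_closed i : closed (B i).
  apply: closedI; first exact: closed_closure.
  rewrite (_ : [set c | _] = proj i @^-1` [set proj i y])//.
  apply: closed_comp; first by move=> ? _; exact: proj_cont.
  exact: system_closed1.
have B_nonempty i : B i !=set0.
  have cP : closed (proj i @` C).
    by apply: compact_image_closed => //; [exact: system_hausdorff|exact: proj_cont].
  suff [c Cc cy] : (proj i @` C) (proj i y) by exists c.
  apply: cP; have := closure_orbit (y := proj i y) (proj i x) (mS i).
  apply: closureS => _ [n _ <-]; exists (iterz n x); last exact: proj_iterz.
  by apply: subset_closure; exists n.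
have BS m n : (m <= n)%N -> B n `<=` B m.
  move=> /subnK <-; elim: (n - m)%N => [//|k IHk] c [Cc ck].
  apply: IHk; split=> //.
  by have := congr1 (@bond _ S (k + m)) ck; rewrite /proj !coord_bond.
have [||_ [i _ <-]|p pB] := @compact_chain X C (range B) cC.
- by exists (B 0%N), 0%N.
- move=> _ _ [m _ <-] [n _ <-].
  by have [/BS|/ltnW/BS] := leqP m n; [right|left].
- by split=> // c [].
have {}pB i : B i p by apply: pB; exists i.
have py : p = y by apply: proj_separate => i; have [] := pB i.
have [Cp _] := pB 0%N.
have [|z [zO Oz]] := Cp O; first by rewrite py; exact: open_nbhs_nbhs.
by exists z.
Qed.

End InverseLimits.

Lemma nilsystem_distal (R : realType) (X : system R) : nilsystem X -> distal X.
Proof.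
move=> [G [Gamma [tau [Gnil _ _ [phi [psi [phiK psiK phic psic phiT]]]]]]].
exact: (coset_system_distal phiK phic psic phiT Gnil).
Qed.

Theorem corollary4p8 (R : realType) (X : system R)
    (hX : invlim_of_minimal_nilsystems X) (d : nat) (hd : (0 < d)%N)
    (x0 x1 : X) :
  IN_pair d x0 x1 <-> RP X d (x0, x1).
Proof.
have [S [lS [phi [psi [phiK _ phic _ phiT]]]]] := hX.
have mX : minimal X.
  by apply: (invlim_minimal phiK phic phiT) => i; have [] := lS i.
have dX : distal X.
  apply: (invlim_distal phiK phic phiT) => i; apply: nilsystem_distal.
  by have [] := lS i.
split; [exact: IN_RP|exact: RP_IN].
Qed.
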